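(* Let $M$ be a simple ternary matroid with non-empty ground set such that every element of $M$ belongs to at least $3$ triangles of $M$. Then $M$ has a minor isomorphic to $P_7$, or $M$ has a minor isomorphic to $M(K_4)$, or $M$ contains $U_{2,4}$ as a submatroid.
   Context: All matroids are finite. A triangle of a matroid is a circuit of cardinality three. A matroid is simple if it has no circuits of size $1$ or $2$. A matroid is ternary if it is representable over $GF(3)$. $M$ contains $N$ as a submatroid if some restriction $M|_X$, $X\subseteq E(M)$, is isomorphic to $N$ (i.e. $N$ is obtained by deletions only). $U_{2,4}$ is the uniform matroid of rank $2$ on $4$ elements; $M(K_4)$ is the cycle matroid of the complete graph $K_4$. $P_7$ is the rank-3 matroid on $7$ elements represented over $GF(3)$ by the columns of $$\begin{pmatrix}1&0&0&1&0&1&1\\0&1&0&1&1&0&1\\0&0&1&-1&1&1&0\end{pmatrix};$$ equivalently, it is the simple rank-3 matroid on $\{1,\dots,7\}$ whose three-element circuits are exactly $\{1,2,7\},\{1,3,6\},\{2,3,5\},\{3,4,7\},\{4,5,6\}$ and in which no four elements lie on a common line. *)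

(* Defs.v *)
(* MathComp. *)
From HB Require Import structures.
From mathcomp Require Import all_boot all_order all_algebra.

Set Implicit Arguments.
Unset Strict Implicit.
Unset Printing Implicit Defensive.

Import GRing.Theory.

(* The ground set is a subset of the carrier type, so that restrictions and
   contractions of a matroid live over the same type. *)
Record matroid (T : finType) := Matroid {
  ground : {set T};
  indep : {set T} -> bool;
  indep_ground : forall X, indep X -> X \subset ground;
  indep0 : indep set0;
  indepS : forall X Y : {set T}, X \subset Y -> indep Y -> indep X;
  indep_aug : forall X Y : {set T}, indep X -> indep Y -> #|X| < #|Y| ->
    exists2 e, e \in Y :\: X & indep (e |: X)
}.

Section MatroidNotions.
Variable T : finType.
Implicit Types (M : matroid T) (X C D : {set T}).

Definition dependent M X := (X \subset ground M) && ~~ indep M X.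

Definition circuit M C := minset (dependent M) C.

Definition triangle M C := circuit M C && (#|C| == 3).

Definition simple_matroid M :=
  forall C, circuit M C -> #|C| <> 1 /\ #|C| <> 2.

Lemma restrict_ground M X (Y : {set T}) :
  (Y \subset X) && indep M Y -> Y \subset ground M :&: X.
Proof. by case/andP=> sYX /indep_ground sYM; rewrite subsetI sYM. Qed.

Lemma restrict_indep0 M X : (set0 \subset X) && indep M set0.
Proof. by rewrite sub0set indep0. Qed.

Lemma restrict_indepS M X (Y Z : {set T}) : Y \subset Z ->
  (Z \subset X) && indep M Z -> (Y \subset X) && indep M Y.
Proof.
move=> sYZ /andP[sZX iZ]; rewrite (subset_trans sYZ sZX).
exact: indepS sYZ iZ.
Qed.

Lemma restrict_aug M X (Y Z : {set T}) :
    (Y \subset X) && indep M Y -> (Z \subset X) && indep M Z -> #|Y| < #|Z| ->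
  exists2 e, e \in Z :\: Y & (e |: Y \subset X) && indep M (e |: Y).
Proof.
move=> /andP[sYX iY] /andP[sZX iZ] ltYZ.
have [e eZY ieY] := indep_aug iY iZ ltYZ; exists e => //.
rewrite ieY andbT subUset sub1set sYX andbT (subsetP sZX) //.
by case/setDP: eZY.
Qed.

Definition restrict M X : matroid T :=
  Matroid (@restrict_ground M X) (restrict_indep0 M X) (@restrict_indepS M X)
          (@restrict_aug M X).

Definition delete M D : matroid T := restrict M (ground M :\: D).

(* B is a basis of M|C. *)
Definition basis_in M C B := maxset (fun I => (I \subset C) && indep M I) B.

(* X is independent in M/C iff it avoids C and X :|: B is independent in M for
   some (equivalently, every) basis B of M|C. *)
Definition contract_indep M C X :=
  [disjoint X & C] && [exists B, basis_in M C B && indep M (X :|: B)].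

Lemma contract_ground M C X : contract_indep M C X -> X \subset ground M :\: C.
Proof.
case/andP=> dXC /existsP[B /andP[_ /indep_ground]].
by rewrite subUset subsetD dXC => /andP[-> _].
Qed.

Lemma contract_indep0 M C : contract_indep M C set0.
Proof.
rewrite /contract_indep disjoints_subset sub0set; apply/existsP.
have [|B mB _] := @maxset_exists _ (fun I => (I \subset C) && indep M I) set0.
  by rewrite sub0set indep0.
exists B; rewrite set0U /basis_in mB.
by case/maxsetP: mB => /andP[].
Qed.

Lemma contract_indepS M C X (Y : {set T}) :
  X \subset Y -> contract_indep M C Y -> contract_indep M C X.
Proof.
move=> sXY /andP[dYC /existsP[B /andP[bB iYB]]].
rewrite /contract_indep (disjointWl sXY dYC); apply/existsP; exists B.
by rewrite bB (indepS _ iYB) // setSU.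
Qed.

Lemma basis_in_leq M C (B I : {set T}) :
  basis_in M C B -> I \subset C -> indep M I -> #|I| <= #|B|.
Proof.
case/maxsetP=> /andP[sBC iB] maxB sIC iI; rewrite leqNgt; apply/negP=> ltBI.
have [e /setDP[eI eB] ieB] := indep_aug iB iI ltBI.
have E : e |: B = B.
  by apply: maxB; rewrite ?subsetUr // ieB subUset sub1set sBC (subsetP sIC).
by case/negP: eB; rewrite -E setU11.
Qed.

Lemma contract_aug M C X (Y : {set T}) :
    contract_indep M C X -> contract_indep M C Y -> #|X| < #|Y| ->
  exists2 e, e \in Y :\: X & contract_indep M C (e |: X).
Proof.
move=> /andP[dXC /existsP[B /andP[bB iXB]]].
move=> /andP[dYC /existsP[B' /andP[bB' iYB']]] ltXY.
have [/andP[sBC iB] maxB] := maxsetP bB.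
have [/andP[sBC' iB'] _] := maxsetP bB'.
have eqB : #|B| = #|B'|.
  by apply/eqP; rewrite eqn_leq (basis_in_leq bB') // (basis_in_leq bB).
have dU (Z W : {set T}) : [disjoint Z & C] -> W \subset C ->
    #|Z :|: W| = #|Z| + #|W|.
  by move=> dZ sW; apply/eqP; rewrite (leq_card_setU Z W) (disjointWr sW).
have [|e /setDP[eY eX] ie] := indep_aug iXB iYB'.
  by rewrite !dU // eqB ltn_add2r.
move: eX; rewrite inE negb_or => /andP[eX eB].
have [eY'|eB'] := setUP eY.
  exists e; first by rewrite inE eX.
  rewrite /contract_indep disjoints_subset subUset sub1set inE.
  rewrite (disjointFr dYC eY') -disjoints_subset dXC /=.
  by apply/existsP; exists B; rewrite bB -setUA.
have E : e |: B = B.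
  apply: maxB; rewrite ?subsetUr // subUset sub1set sBC (subsetP sBC') //=.
  by apply: indepS ie; rewrite setUS // subsetUr.
by case/negP: eB; rewrite -E setU11.
Qed.

Definition contract M C : matroid T :=
  Matroid (@contract_ground M C) (contract_indep0 M C) (@contract_indepS M C)
          (@contract_aug M C).

End MatroidNotions.

(* As f is total on the carrier T, this is isomorphism as usual except for the
   degenerate case of two empty ground sets with T inhabited and T' empty. *)
Definition matroid_iso (T T' : finType) (M : matroid T) (N : matroid T') :=
  exists f : T -> T',
    [/\ {in ground M &, injective f},
        f @: ground M = ground N &
        forall X : {set T}, X \subset ground M ->
          indep M X = indep N (f @: X)].

Definition has_minor (T T' : finType) (M : matroid T) (N : matroid T') :=
  exists C D : {set T},
    [/\ C \subset ground M, D \subset ground M, [disjoint C & D] &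
        matroid_iso (delete (contract M C) D) N].

Definition has_submatroid (T T' : finType) (M : matroid T) (N : matroid T') :=
  exists X : {set T}, X \subset ground M /\ matroid_iso (restrict M X) N.

Section Uniform.
Variables r n : nat.

Let ui (X : {set 'I_n}) := #|X| <= r.

Lemma uniform_ground X : ui X -> X \subset [set: 'I_n].
Proof. by rewrite subsetT. Qed.

Lemma uniform_indep0 : ui set0.
Proof. by rewrite /ui cards0. Qed.

Lemma uniform_indepS (X Y : {set 'I_n}) : X \subset Y -> ui Y -> ui X.
Proof. by move/subset_leq_card/leq_trans; apply. Qed.

Lemma uniform_aug (X Y : {set 'I_n}) : ui X -> ui Y -> #|X| < #|Y| ->
  exists2 e, e \in Y :\: X & ui (e |: X).
Proof.
rewrite /ui => _ leY ltXY.
have /set0Pn[e eYX] : Y :\: X != set0.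
  rewrite setD_eq0; apply/negP=> /subset_leq_card.
  by rewrite leqNgt ltXY.
exists e => //; case/setDP: eYX => _ eX.
by rewrite cardsU1 eX (leq_trans ltXY).
Qed.

Definition uniform_matroid : matroid 'I_n :=
  Matroid uniform_ground uniform_indep0 uniform_indepS uniform_aug.

End Uniform.

Section FreeFamily.
Local Open Scope ring_scope.
Variables (F : fieldType) (vT : vectType F) (T : finType) (v : T -> vT).
Implicit Types X Y : {set T}.

(* As v may identify elements of X, independence is that of the family (v x),
   x in X, and not of its set of values. *)
Definition free_family X := free [seq v x | x <- enum X].

Lemma free_family0 : free_family set0.
Proof. by rewrite /free_family enum_set0 nil_free. Qed.

Lemma perm_enum_setU1 (e : T) X : e \notin X ->
  perm_eq (enum (e |: X)) (e :: enum X).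
Proof.
move=> eX; apply: uniq_perm; rewrite ?enum_uniq //= ?mem_enum ?eX ?enum_uniq //.
by move=> x; rewrite inE !mem_enum !inE.
Qed.

Lemma free_familyU1 (e : T) X : e \notin X ->
  free_family (e |: X) =
    (v e \notin <<[seq v x | x <- enum X]>>%VS) && free_family X.
Proof.
move=> eX; rewrite /free_family (perm_free (perm_map v (perm_enum_setU1 eX))).
by rewrite /= free_cons.
Qed.

Lemma free_familyS X Y : X \subset Y -> free_family Y -> free_family X.
Proof.
move=> sXY; rewrite /free_family.
have P : perm_eq (enum Y) (enum X ++ enum (Y :\: X)).
  apply: uniq_perm; rewrite ?enum_uniq //.
    rewrite cat_uniq !enum_uniq andbT /=; apply/hasPn=> x.
    by rewrite !mem_enum inE => /andP[].
  move=> x; rewrite mem_cat !mem_enum inE.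
  by case: (boolP (x \in X)) => // /(subsetP sXY).
by rewrite (perm_free (perm_map v P)) map_cat => /catl_free.
Qed.

Lemma free_family_aug X Y : free_family X -> free_family Y -> (#|X| < #|Y|)%N ->
  exists2 e, e \in Y :\: X & free_family (e |: X).
Proof.
move=> fX fY ltXY.
have [e /andP[eYX feX]|none] :=
    pickP [pred e | (e \in Y :\: X) && free_family (e |: X)].
  by exists e.
have sub : (<<[seq v x | x <- enum Y]>> <= <<[seq v x | x <- enum X]>>)%VS.
  apply/span_subvP=> w /mapP[y]; rewrite mem_enum => yY -> {w}.
  case: (boolP (y \in X)) => [yX|yX].
    by apply: memv_span; apply: map_f; rewrite mem_enum.
  move: (none y); rewrite /= inE yX yY /= free_familyU1 // fX andbT.
  by move/negbFE.
move: (dimvS sub); rewrite (eqnP fY) => /leq_trans/(_ (dim_span _)).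
by rewrite !size_map -!cardE leqNgt ltXY.
Qed.

End FreeFamily.

Section VectorMatroid.
Local Open Scope ring_scope.
Variables (F : fieldType) (m n : nat) (A : 'M[F]_(m, n)).

Let vi := free_family (fun j : 'I_n => col j A).

Lemma vector_ground X : vi X -> X \subset [set: 'I_n].
Proof. by rewrite subsetT. Qed.

(* The matroid M[A] on the column labels of A. *)
Definition vector_matroid : matroid 'I_n :=
  Matroid vector_ground (free_family0 _) (@free_familyS _ _ _ _)
          (@free_family_aug _ _ _ _).

End VectorMatroid.

Definition representable (F : fieldType) (T : finType) (M : matroid T) :=
  exists m n (A : 'M[F]_(m, n)), matroid_iso M (vector_matroid A).

Definition ternary (T : finType) (M : matroid T) := representable 'F_3 M.

Record sgraph (V : finType) := SGraph {
  edges : {set {set V}};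
  edges_card2 : {in edges, forall e : {set V}, #|e| = 2}
}.

Section CycleMatroid.
Variables (V : finType) (G : sgraph V).
Implicit Types (X : {set {set V}}) (e : {set V}) (x y : V).

Definition adj X : rel V := [rel x y | [set x; y] \in X].

(* Closed walks without repeated vertices; those with at most two vertices
   (such as u, v, u along a single edge) are not cycles of a simple graph.
   The length bound on c is harmless (acyclicP). *)
Definition acyclic X :=
  [forall c : {bseq #|V| of V}, uniq c && cycle (adj X) c ==> (size c <= 2)].

Definition forest X := (X \subset edges G) && acyclic X.

Lemma acyclicP X :
  reflect (forall c : seq V, uniq c -> cycle (adj X) c -> size c <= 2)
          (acyclic X).
Proof.
apply: (iffP forallP) => [H c uc cc | H c]; last first.
  by apply/implyP=> /andP[]; apply: H.
have sc : size c <= #|V| by rewrite -(card_uniqP uc) max_card.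
by have := H (Bseq sc); rewrite /= uc cc.
Qed.

Let vec e : {ffun V -> ('F_2)^o%R} := [ffun x => ((x \in e)%:R)%R].

Let sp X := <<[seq vec e | e <- enum X]>>%VS.

Let sum_vec2 (K : pred V) x y : x != y ->
  (\sum_(z | K z) vec [set x; y] z = (K x)%:R + (K y)%:R)%R.
Proof.
move=> nxy; under eq_bigr => z _ do rewrite ffunE.
rewrite -natr_sum big_mkcond /= (bigD1 x) //= (bigD1 y) /= 1?eq_sym //.
rewrite big1 => [|z /andP[zx zy]].
  rewrite !inE !eqxx orbT addn0 natrD /=.
  by do 2 case: (K _).
by rewrite !inE (negbTE zx) (negbTE zy); case: (K z).
Qed.

Let edge2 e : e \in edges G -> exists x y, x != y /\ e = [set x; y].
Proof.
by move/edges_card2/eqP/cards2P=> [x [y [nxy ->]]]; exists x, y.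
Qed.

Lemma adj_sym X : symmetric (adj X).
Proof. by move=> x y; rewrite /adj /= setUC. Qed.

Let vec_notin_span X x y : X \subset edges G -> x != y ->
  ~~ connect (adj X) x y -> vec [set x; y] \notin sp X.
Proof.
move=> sXG nxy ncxy; apply/negP=> /(coord_span (X := in_tuple _)) E.
have : (\sum_(z | connect (adj X) x z) vec [set x; y] z = 0 :> 'F_2)%R.
  under eq_bigr => z _ do rewrite E sum_ffunE.
  rewrite exchange_big big1 //= => i _.
  under eq_bigr => z _ do rewrite ffunE.
  rewrite -scaler_sumr; set w := (nth _ _ _).
  have [f fX ->] : exists2 f, f \in X & w = vec f.
    have : w \in [seq vec e | e <- enum X] by apply: mem_nth.
    by case/mapP=> f; rewrite mem_enum; exists f.
  have [a [b [nab Ef]]] := edge2 (subsetP sXG _ fX).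
  rewrite Ef sum_vec2 //.
  have cab : connect (adj X) a b by apply: connect1; rewrite /adj /= -Ef.
  have csym := sym_connect_sym (adj_sym X).
  rewrite (same_connect_r csym cab).
  by case: (connect _ _ _); rewrite ?addr0 ?scaler0 //= -natrD pchar_Zp ?scaler0.
by rewrite sum_vec2 // connect0 (negbTE ncxy) addr0 => /eqP; rewrite oner_eq0.
Qed.

Let vecD x y z : x != y -> y != z -> x != z ->
  vec [set x; z] = (vec [set x; y] + vec [set y; z])%R.
Proof.
move=> nxy nyz nxz; apply/ffunP=> w; rewrite !ffunE !inE.
have [->|nwx] := eqVneq w x; first by rewrite (negbTE nxy) (negbTE nxz) addr0.
have [->|nwy] := eqVneq w y.
  by rewrite (negbTE nyz) /= -natrD pchar_Zp.
by rewrite /= add0r.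
Qed.

Let vec_in_span X x p : X \subset edges G -> uniq (x :: p) -> p != [::] ->
  path (adj X) x p -> vec [set x; last x p] \in sp X.
Proof.
move=> sXG; elim: p x => // y [|z p] IHp x up _ /= /andP[axy pyp].
  by apply: memv_span; apply: map_f; rewrite mem_enum.
have [] := and3P up; rewrite !inE !negb_or => /and3P[nxy nxz nxp].
move=> /andP[nyz nyp] up'.
have nl w : w != z -> w \notin p -> w != last z p.
  move=> nwz nwp; apply/eqP=> E; have := mem_last z p.
  by rewrite -E inE (negbTE nwz) (negbTE nwp).
rewrite (vecD (y := y)) ?nl //; apply: memvD; last first.
  by apply: (IHp y) => //; case/andP: up.
by apply: memv_span; apply: map_f; rewrite mem_enum.
Qed.

Let free_acyclic X : X \subset edges G -> free_family vec X -> acyclic X.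
Proof.
move=> sXG fX; apply/acyclicP=> -[|x p] // up cp; rewrite leqNgt.
apply/negP=> lt2p; pose y := last x p; pose e := [set y; x].
move: cp; rewrite /= rcons_path => /andP[pp ayx].
have eX : e \in X by [].
have sX' : X :\ e \subset edges G by apply: subset_trans sXG; apply: subsetDl.
have np : p != [::] by apply: contraTneq lt2p => ->.
move: fX; rewrite -(setD1K eX) free_familyU1 ?setD11 // => /andP[/negP nespan _]; apply: nespan.

have -> : vec e = vec [set x; y] by rewrite /e setUC.
apply: vec_in_span => //.
have adjX (a b : V) : a != x -> b != x -> adj X a b -> adj (X :\ e) a b.
  move=> na nb; rewrite /adj /= !inE => ->; rewrite andbT.
  apply: contraNneq na => E.
  have : x \in [set a; b] by rewrite E !inE eqxx orbT.
  by rewrite !inE !(eq_sym x) (negbTE nb) orbF.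
case: p => [|z [|w q]] // in up lt2p y e pp ayx eX sX' np adjX *.
move: pp => /= /andP[axz pz]; apply/andP; split.
  move: axz; rewrite /adj /= !inE => ->; rewrite andbT.
  have nxz : x != z by case/and3P: up; rewrite inE negb_or => /andP[].
  have nzy : z != y.
    case/and3P: up => _ /negP zq _; apply/eqP=> E; apply: zq.
    by rewrite E /y /= mem_last.
  apply: contraNneq nzy => E.
  have : z \in [set y; x] by rewrite -/e -E !inE eqxx orbT.
  by rewrite !inE (eq_sym z x) (negbTE nxz) orbF.
have nx : all (predC1 x) [:: z, w & q].
  by apply/allP=> a aq /=; apply: contraTneq aq => ->; case/andP: up.
apply: (sub_in_path (P := predC1 x) _ nx pz) => a b na nb.
exact: adjX.
Qed.

Let acyclicS X (Y : {set {set V}}) : X \subset Y -> acyclic Y -> acyclic X.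
Proof.
move=> sXY /acyclicP aY; apply/acyclicP=> c uc cc; apply: aY => //.
by apply: sub_cycle cc => x y; apply: (subsetP sXY).
Qed.

Let acyclic_free X : X \subset edges G -> acyclic X -> free_family vec X.
Proof.
have [n] := ubnP #|X|; elim: n X => // n IHn X /ltnSE-leXn sXG aX.
have [->|/set0Pn[e eX]] := eqVneq X set0; first exact: free_family0.
have sX' : X :\ e \subset X by apply: subsetDl.
rewrite -(setD1K eX) free_familyU1 ?setD11 // IHn ?(acyclicS sX') //; first last.
- exact: subset_trans sXG.
- by move: leXn; rewrite (cardsD1 e) eX.
have [x [y [nxy Ee]]] := edge2 (subsetP sXG _ eX).
rewrite andbT Ee vec_notin_span -?Ee ?(subset_trans sX') //.
apply/negP=> /connectP[p0 pp0]; case/shortenP: pp0 => p pp up _ Ey {p0}.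
have /acyclicP/(_ (x :: p) up) := aX.
rewrite /= rcons_path -Ey => H.
have {H} : size p < 2.
  apply: H; rewrite (sub_path _ pp) /=; last first.
    by move=> a b; apply: (subsetP sX').
  by rewrite /adj /= setUC -Ee.
case: p => [|z [|]] // in pp up Ey * => _.
  by move: nxy; rewrite Ey eqxx.
by move: pp Ey => /= + Ey; rewrite -Ey /adj /= -Ee setD11.
Qed.

Let forest_free X : forest X = (X \subset edges G) && free_family vec X.
Proof.
rewrite /forest; case: (boolP (X \subset edges G)) => //= sXG.
by apply/idP/idP; [apply: acyclic_free | apply: free_acyclic].
Qed.

Lemma forest_ground X : forest X -> X \subset edges G.
Proof. by case/andP. Qed.

Lemma forest0 : forest set0.
Proof. by rewrite forest_free sub0set free_family0. Qed.

Lemma forestS X (Y : {set {set V}}) : X \subset Y -> forest Y -> forest X.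
Proof.
move=> sXY /andP[sYG aY].
by rewrite /forest (subset_trans sXY) // (acyclicS sXY).
Qed.

Lemma forest_aug X (Y : {set {set V}}) :
    forest X -> forest Y -> #|X| < #|Y| ->
  exists2 e, e \in Y :\: X & forest (e |: X).
Proof.
rewrite !forest_free => /andP[sXG fX] /andP[sYG fY] ltXY.
have [e eYX feX] := free_family_aug fX fY ltXY; exists e => //.
rewrite forest_free feX subUset sub1set sXG (subsetP sYG) //.
by case/setDP: eYX.
Qed.

Definition cycle_matroid : matroid {set V} :=
  Matroid forest_ground forest0 forestS forest_aug.

End CycleMatroid.

Lemma complete_edges_card2 (V : finType) :
  {in [set e : {set V} | #|e| == 2], forall e : {set V}, #|e| = 2}.
Proof. by move=> e; rewrite inE => /eqP. Qed.

Definition complete_graph (V : finType) : sgraph V :=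
  SGraph (@complete_edges_card2 V).

Definition U24 := uniform_matroid 2 4.

Definition MK4 := cycle_matroid (complete_graph 'I_4).

Section P7.
Local Open Scope ring_scope.

Let P7rows : seq (seq 'F_3) :=
  [:: [:: 1; 0; 0;  1; 0; 1; 1];
      [:: 0; 1; 0;  1; 1; 0; 1];
      [:: 0; 0; 1; -1; 1; 1; 0]].

Definition P7mx : 'M['F_3]_(3, 7) := \matrix_(i, j) nth 0 (nth [::] P7rows i) j.

Definition P7 := vector_matroid P7mx.

End P7.

(* Main.v *)
Require Import Defs.
From Stdlib Require Import Classical.
From mathcomp Require Import all_boot all_order all_algebra.
From mathcomp Require Import ring zify.

(** Represent M by vectors over GF(3), and replace the ground set by the set S
    of all vectors plus or minus v(x); a point is then a pair of opposite vectors
    of S. Contracting a set C of points amounts to applying a linear map p whose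
    kernel is spanned by C, so a minor of M is found as soon as the image of S
    under such a p contains suitable vectors: the six differences of four affinely
    independent vectors for M(K_4), a linear image of the seven columns for P_7.

    The theorem is a counting argument. Write n for the number of points of S,
    and let s be the sum, over the lines with at least three points, of the
    number of points minus two. The claim is that, if no projection of S shows
    M(K_4) or P_7, then s < n as soon as S is non-empty. A line with at least three
    points has three or four points, and (k - 2) / (k (k - 1)) is
    1/6 for both k = 3 and k = 4. Hence 6 s is the number of ordered pairs of
    distinct points that lie on a line with a third point. Counting vectors
    instead of points multiplies this by four, and the claim becomes
    npairs S < 12 #|S|, a statement in which lines no longer occur explicitly.

    The claim is proved by induction, projecting from a point e of S to obtain
    S'. The pairs whose line passes through e are counted fibre by fibre; there are
    at most 12 (#|S| - 2 - #|S'|) of them. A pair whose line avoids e projects to a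
    pair of S' with the same property, and it remains to see that the images are
    not hit too often. In a plane through e with k directions occupied, the bound
    needed is that the lines L avoiding e satisfy the inequality
    sum (|L| - 2) <= k - 2. This is where M(K_4) and P_7 enter.
    - Two different lines avoiding e and occupying the same three directions
      differ by shifts t1, t2, t3 along e with t1 + t2 + t3 = 0, not all zero. If
      one shift is zero, the two lines meet in a point and with e they form an
      M(K_4). Otherwise all three are equal, and the seven points form a P_7
      (unique_line_over).
    - Three different lines avoiding e, each missing a different direction, are
      excluded by the same two configurations, with another point as the centre
      (three_lines_over).
    The four directions of a plane are treated through the involution that sends
    two of them, spanned by d1 and d2, to the other two, spanned by d1 + d2 and
    d1 - d2 (fibre_pair, npairs_projection, pair_bound).

    Finally, if every element is in at least three triangles and no line has four
    points, then the triangles at an element have nothing else in common, so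
    every point shares a long line with at least six others. This gives
    npairs S >= 12 #|S| and contradicts the claim. *)

Set Implicit Arguments.
Unset Strict Implicit.
Unset Printing Implicit Defensive.
Import GRing.Theory.

(** * Lines in a plane over the field with three elements *)

Section ThreeElements.
Local Open Scope ring_scope.

Lemma F3P (t : 'F_3) : [\/ t = 0, t = 1 | t = -1].
Proof.
case: t => [[|[|[|//]]] ?]; [apply: Or31 | apply: Or32 | apply: Or33];
exact: val_inj.
Qed.

End ThreeElements.

(** Vector identities over GF(3), checked entrywise: the first tactic tries all
    values of the entries and so may use 3 = 0, the second one may not. *)
Ltac vec3 := apply/matrixP=> ? ?; rewrite !mxE;
  repeat match goal with |- context [fun_of_matrix ?x ?i ?j] =>
    case: (F3P (fun_of_matrix x i j)) => -> end; exact: val_inj.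

Ltac vring := let r := fresh in let s := fresh in
  apply/matrixP=> r s; rewrite !mxE; ring.

Section Plane.
Local Open Scope ring_scope.
Variable m : nat.
Notation V := 'cV['F_3]_m.
Implicit Types (S : {set V}) (a b c d e x y z w : V).

Lemma free3P a b c :
  reflect (forall i j k, i *: a + j *: b + k *: c = 0 -> [/\ i = 0, j = 0 & k = 0])
          (free [:: a; b; c]).
Proof.
apply: (iffP (freeP (X := [tuple a; b; c]))) => [H i j k E|H k].
  have /H K : \sum_(l < 3) [tuple i; j; k]`_l *: [tuple a; b; c]`_l = 0.
    by rewrite !big_ord_recl big_ord0 /= addr0 addrA.
  by have := (K ord0, K (inord 1), K (inord 2)); rewrite /= !inordK //= => -[[-> ->] ->].
rewrite !big_ord_recl big_ord0 addr0 addrA /= => /H[k0 k1 k2].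
case=> [[|[|[|//]]] lti].
- by rewrite -[RHS]k0; congr k; apply: val_inj.
- by rewrite -[RHS]k1; congr k; apply: val_inj.
by rewrite -[RHS]k2; congr k; apply: val_inj.
Qed.

Definition symmetric_set S := forall x, (- x \in S) = (x \in S).

(** The differences of the four vectors 0, a, b and c. *)
Definition K4_config S := exists a b c : V, free [:: a; b; c] /\
  [/\ a \in S, b \in S & c \in S] /\
  [/\ a - b \in S, a - c \in S & b - c \in S].

(** The columns of the matrix of P_7 in the basis a, b, c. *)
Definition P7_config S := exists a b c : V, free [:: a; b; c] /\
  [/\ a \in S, b \in S & c \in S] /\
  [/\ a + b - c \in S, b + c \in S, a + c \in S & a + b \in S].

Definition K4P7_free S := [/\ symmetric_set S, 0 \notin S, ~ K4_config S & ~ P7_config S].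

Section NoConfiguration.
Variable S : {set V}.
Hypothesis S_free : K4P7_free S.

Let symS : symmetric_set S. Proof. by case: S_free. Qed.

Let memN x y : x \in S -> y = - x -> y \in S.
Proof. by move=> xS ->; rewrite symS. Qed.

(** The lines {x, y, x + y} and {x, y + e, x + y + e} meet in x and are
    transversal to the two lines {e, y, y + e} and {e, x + y, x + y + e}. *)
Lemma K4_of_lines_meeting e x y :
  free [:: e; x; y] -> e \in S -> x \in S -> y \in S -> x + y \in S ->
  y + e \in S -> x + y + e \in S -> False.
Proof.
move=> /free3P fr eS xS yS xyS yeS xyeS; have [_ _ K4 _] := S_free; case: K4.
exists x, (- y), (- (y + e)); split; last first.
  rewrite !symS xS yS yeS !opprK addrA xyS xyeS; do 2 split=> //.
  by rewrite (_ : _ + _ = e) //; apply/matrixP=> r s; rewrite !mxE; ring.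
apply/free3P=> i j k E.
have /fr[k0 i0 jk] : (- k) *: e + i *: x + (- j - k) *: y = 0.
  by rewrite -E; apply/matrixP=> r s; rewrite !mxE; ring.
have {}k0 : k = 0 by apply/eqP; rewrite -oppr_eq0 k0.
by move: jk; rewrite k0 subr0 => /eqP; rewrite oppr_eq0 => /eqP.
Qed.

(** A P_7 with tip e: its three legs are the pairs of points over the directions
    x, y and x + y, and both zero-sum transversals are lines. *)
Lemma P7_of_parallel_shift e x y :
  free [:: e; x; y] -> e \in S -> x \in S -> y \in S -> x + y \in S ->
  x + e \in S -> y + e \in S -> x + y - e \in S -> False.
Proof.
move=> /free3P fr eS xS yS xyS xeS yeS xyeS; have [_ _ _ P7] := S_free; case: P7.
exists (x + e), (y + e), (- e); split; last first.
  rewrite symS xeS yeS eS; split=> //.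
  rewrite (_ : _ + _ - _ = x + y); last by vec3.
  rewrite (_ : x + e + (y + e) = x + y - e); last by vec3.
  by rewrite !addrK.
apply/free3P=> i j k E.
have /fr[k0 i0 j0] : (i + j - k) *: e + i *: x + j *: y = 0.
  by rewrite -E; apply/matrixP=> r s; rewrite !mxE; ring.
split=> //; move: k0; rewrite i0 j0 !add0r => /eqP.
by rewrite oppr_eq0 => /eqP.
Qed.

Lemma free3N e x y : free [:: - e; x; y] = free [:: e; x; y].
Proof.
apply/free3P/free3P=> H i j k E.
  have [|/eqP] := H (- i) j k; first by rewrite scaleNr scalerN opprK.
  by rewrite oppr_eq0 => /eqP-> -> ->.
have [|/eqP] := H (- i) j k; first by rewrite scaleNr -scalerN.
by rewrite oppr_eq0 => /eqP-> -> ->.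
Qed.

Lemma free3_swap e x y : free [:: e; y; x] = free [:: e; x; y].
Proof. by apply: perm_free; rewrite perm_cons (perm_catC [:: y] [:: x]). Qed.

Let shift0 e x y s :
  free [:: e; x; y] -> e \in S -> x \in S -> y \in S -> x + y \in S ->
  y + s *: e \in S -> x + y + s *: e \in S -> s = 0.
Proof.
move=> f eS xS yS xyS; case: (F3P s) => -> //; rewrite ?scaleN1r ?scale1r => yeS xyeS.
  by case: (K4_of_lines_meeting f eS xS yS xyS yeS xyeS).
by case: (@K4_of_lines_meeting (- e) x y); rewrite ?free3N ?symS.
Qed.

Let shift_diag e x y s :
  free [:: e; x; y] -> e \in S -> x \in S -> y \in S -> x + y \in S ->
  x + s *: e \in S -> y + s *: e \in S -> x + y - s *: e \in S -> s = 0.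
Proof.
move=> f eS xS yS xyS; case: (F3P s) => -> //; rewrite ?scaleN1r ?scale1r => xeS yeS xyeS.
  by case: (P7_of_parallel_shift f eS xS yS xyS xeS yeS xyeS).
by case: (@P7_of_parallel_shift (- e) x y); rewrite ?free3N ?symS.
Qed.

(** Two lines over the same three directions modulo e differ by shifts t, s and
    -(t + s) of the points x, y and -(x + y). If one of the shifts vanishes, the
    lines have a common point and M(K_4) appears; otherwise t = s, because t and s
    are then both 1 or -1 and not opposite, and P_7 appears. *)
Lemma unique_line_over e x y t s :
  free [:: e; x; y] -> e \in S -> x \in S -> y \in S -> x + y \in S ->
  x + t *: e \in S -> y + s *: e \in S -> (x + t *: e) + (y + s *: e) \in S ->
  t = 0 /\ s = 0.
Proof.
move=> f eS xS yS xyS xeS yeS; rewrite addrACA -scalerDl => xyeS.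
have f' : free [:: e; y; x] by rewrite free3_swap.
have [t0|tn0] := eqVneq t 0.
  by split=> //; apply: (shift0 f eS xS yS xyS yeS); rewrite t0 add0r in xyeS.
have [s0|sn0] := eqVneq s 0.
  rewrite addrC in xyS; rewrite s0 addr0 [x + y]addrC in xyeS.
  by case/eqP: tn0; apply: (shift0 f' eS yS xS xyS xeS xyeS).
have [st|st] := eqVneq s t.
  case/eqP: tn0; apply: (shift_diag f eS xS yS xyS xeS); first by rewrite -st.
  have tt : t + t = - t by case: (F3P t) => ->; apply: val_inj.
  by move: xyeS; rewrite st tt scaleNr.
have /eqP : t + s = 0.
  by case: (F3P t) tn0 st => ->; case: (F3P s) sn0 => -> sn0 tn0 st;
    first [exact: val_inj | case/eqP: sn0 | case/eqP: tn0 | case/eqP: st].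
rewrite addrC addr_eq0 => /eqP Es.
(* Only the third point is common: it takes the role of x. *)
have fxy : free [:: e; x + y; - x].
  apply/free3P=> i j k E.
  have /(elimT (free3P e x y) f)[i0 jk j0] : i *: e + (j - k) *: x + j *: y = 0.
    by rewrite -E; apply/matrixP=> r q; rewrite !mxE; ring.
  by move: jk; rewrite i0 j0 sub0r => /eqP; rewrite oppr_eq0 => /eqP ->.
have xNS : - x \in S by rewrite symS.
case/eqP: sn0; apply: (shift0 fxy eS xyS xNS); first by rewrite addrC addKr.
  by apply: memN xeS _; rewrite Es scaleNr; apply/matrixP=> r q; rewrite !mxE; ring.
by rewrite (_ : _ + _ + _ = y + s *: e) //; apply/matrixP=> r q; rewrite !mxE; ring.
Qed.

Let memE x y : x \in S -> y = x -> y \in S.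
Proof. by move=> xS ->. Qed.

(* Independence of three combinations of e, x, y, read off the coefficients. *)
Let free_comb e x y a b c (M : 'F_3 -> 'F_3 -> 'F_3 -> 'F_3 * 'F_3 * 'F_3) :
  free [:: e; x; y] ->
  (forall i j k, let: (p, q, r) := M i j k in
     i *: a + j *: b + k *: c = p *: e + q *: x + r *: y) ->
  (forall i j k, M i j k == (0, 0, 0) -> [&& i == 0, j == 0 & k == 0]) ->
  free [:: a; b; c].
Proof.
move=> /free3P f HM M0; apply/free3P=> i j k E.
have := M0 i j k; have := HM i j k; rewrite E.
case: (M i j k) => [[p q] r] /esym/f[-> -> ->].
by case/(_ isT)/and3P=> /eqP-> /eqP-> /eqP->.
Qed.

Ltac f3enum := let i := fresh in let j := fresh in let k := fresh in
  move=> i j k; case: (F3P i) => ->; case: (F3P j) => ->; case: (F3P k) => ->; done.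

(* The three lines are the graphs, over the four directions x, y, x + y, x - y,
   of the linear forms with values (0, 0), (i, j) and (k, 1) at (x, y). *)
Let three_lines_aux e x y i j k :
  free [:: e; x; y] -> e \in S -> x \in S -> y \in S -> x + y \in S ->
  x + i *: e \in S -> y + j *: e \in S -> (x + i *: e) - (y + j *: e) \in S ->
  x + k *: e \in S -> x + y + (k + 1) *: e \in S ->
  x - y + (k - 1) *: e \in S ->
  i = 0 /\ j = 0.
Proof.
move=> f eS xS yS xyS xeS yeS xyeS xkS xykS xymS.
have xmS : (x - y \in S) -> i = 0 /\ j = 0.
  move=> xmyS; have f' : free [:: e; x; - y].
    by apply: (free_comb (M := fun i j k => (i, j, - k)) f) => [*|]; [vring|f3enum].
  have yNS : - y \in S by rewrite symS.
  have [||-> /eqP] := @unique_line_over e x (- y) i (- j) f' eS xS yNS xmyS xeS.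
  - by apply: memN yeS _; vring.
  - by apply: memE xyeS _; vring.
  by rewrite oppr_eq0 => /eqP.
have xpS : ((x + i *: e) + (y + j *: e) \in S) -> i = 0 /\ j = 0.
  by move=> H; apply: (unique_line_over f eS xS yS xyS xeS yeS H).
(* Each of c1, ..., c6 settles one arrangement of the three lines; the centre, the
   first vector of the triple that is passed on, is in general not e. *)
have comb a b c M := free_comb (a := a) (b := b) (c := c) (M := M) f.
have c1 : k = 0 -> i = 0 -> j = -1 -> False.
  move=> Ek Ei Ej; subst i j k; apply: (@P7_of_parallel_shift x y (y - e - x)).
  - by apply: (comb _ _ _ (fun i j k => (- k, i - k, j + k))) => [*|]; [vring|f3enum].
  - exact: xS.
  - exact: yS.
  - by apply: memN xyeS _; vec3.
  - by apply: memN xykS _; vec3.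
  - by apply: memE xyS _; vec3.
  - by apply: memE yeS _; vec3.
  - by apply: memE xymS _; vec3.
have c2 : k = 0 -> i = -1 -> j = 0 -> False.
  move=> Ek Ei Ej; subst i j k; apply: (@P7_of_parallel_shift x y (x - y - e)).
  - by apply: (comb _ _ _ (fun i j k => (- k, i + k, j - k))) => [*|]; [vring|f3enum].
  - exact: xS.
  - exact: yS.
  - by apply: memE xyeS _; vec3.
  - by apply: memE xeS _; vec3.
  - by apply: memE xyS _; vec3.
  - by apply: memN xykS _; vec3.
  - by apply: memN eS _; vec3.
have c3 : k = -1 -> i = 0 -> j = -1 -> False.
  move=> Ek Ei Ej; subst i j k; apply: (@P7_of_parallel_shift x y (e - y)).
  - by apply: (comb _ _ _ (fun i j k => (k, i, j - k))) => [*|]; [vring|f3enum].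
  - exact: xS.
  - exact: yS.
  - by apply: memN yeS _; vec3.
  - by apply: memE eS _; vec3.
  - by apply: memE xyS _; vec3.
  - by apply: memE xymS _; vec3.
  - by apply: memN xkS _; vec3.
have c4 : k = -1 -> i = 1 -> j = 0 -> False.
  move=> Ek Ei Ej; subst i j k; apply: (@K4_of_lines_meeting y (x - e) x).
  - by apply: (comb _ _ _ (fun i j k => (- j, j + k, i))) => [*|]; [vring|f3enum].
  - exact: yS.
  - by apply: memE xkS _; vec3.
  - exact: xS.
  - by apply: memN xeS _; vec3.
  - exact: xyS.
  - by apply: memN xyeS _; vec3.
have c5 : k = -1 -> i = -1 -> j = 0 -> False.
  move=> Ek Ei Ej; subst i j k; apply: (@P7_of_parallel_shift (e - x) y (- x - y)).
  - by apply: (comb _ _ _ (fun i j k => (i, - i - k, j - k))) => [*|]; [vring|f3enum].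
  - by apply: memN xkS _; vec3.
  - exact: yS.
  - by apply: memN xyS _; vec3.
  - by apply: memN xS _; vec3.
  - by apply: memN xyeS _; vec3.
  - by apply: memE xymS _; vec3.
  - by apply: memN eS _; vec3.
have c6 : k = -1 -> i = 0 -> j = 1 -> False.
  move=> Ek Ei Ej; subst i j k; apply: (@K4_of_lines_meeting e (y + e) (- x)).
  - by apply: (comb _ _ _ (fun i j k => (i + j, - k, j))) => [*|]; [vring|f3enum].
  - exact: eS.
  - by apply: memE yeS _; vec3.
  - by apply: memN xS _; vec3.
  - by apply: memN xyeS _; vec3.
  - by apply: memN xkS _; vec3.
  - by apply: memN xymS _; vec3.
have Ek1 : k = 1 -> i = 0 /\ j = 0.
  by move=> k1; apply: xmS; apply: memE xymS _; rewrite k1; vring.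
have Eij : i = j -> i = 0 /\ j = 0.
  by move=> ij; apply: xmS; apply: memE xyeS _; rewrite ij; vring.
have iNj : i = - j -> i = 0 /\ j = 0.
  by move=> ij; apply: xpS; apply: memE xyS _; rewrite ij; vring.
have Eijk : i + j = k + 1 -> i = 0 /\ j = 0.
  move=> ijk; apply: xpS; apply: memE xykS _.
  by rewrite -ijk; vring.
have [Ek|Ek|Ek] := F3P k; first last.
- have [Ei|Ei|Ei] := F3P i; have [Ej|Ej|Ej] := F3P j;
  by [split | apply: Eijk; rewrite Ek Ei Ej; apply: val_inj | apply: Eij; rewrite Ei Ej
   | apply: iNj; rewrite Ei Ej; apply: val_inj | case: c3 | case: c4 | case: c5 | case: c6].
- exact: Ek1.
- have [Ei|Ei|Ei] := F3P i; have [Ej|Ej|Ej] := F3P j;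
  by [split | apply: Eijk; rewrite Ek Ei Ej; apply: val_inj | apply: Eij; rewrite Ei Ej
   | apply: iNj; rewrite Ei Ej; apply: val_inj | case: c1 | case: c2].
Qed.

(** The three lines contain points over x, y, x + y, over x, y, x - y and over
    x, x + y, x - y. By unique_line_over, two different ones share only two
    directions, and then they meet in a point of S over one of these. If some point is on
    three of the lines considered (those through e included), or if the three
    remaining points are on one line through e, then the same two configurations
    M(K_4) and P_7 appear, with one of these points as the centre. *)
Lemma three_lines_over e x y i j k l :
  free [:: e; x; y] -> e \in S -> x \in S -> y \in S -> x + y \in S ->
  x + i *: e \in S -> y + j *: e \in S -> (x + i *: e) - (y + j *: e) \in S ->
  x + k *: e \in S -> x + y + (k + l) *: e \in S ->
  x - y + (k - l) *: e \in S ->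
  i = 0 /\ j = 0.
Proof.
move=> f eS xS yS xyS xeS yeS xyeS xkS xykS xymS.
have [l0|l1|l1] := F3P l; first last.
- have [|||||||||||/eqP] := @three_lines_aux (- e) x y (- i) (- j) (- k).
  - by rewrite free3N.
  - by rewrite symS.
  - exact: xS.
  - exact: yS.
  - exact: xyS.
  - by rewrite scalerN scaleNr opprK.
  - by rewrite scalerN scaleNr opprK.
  - by rewrite !(scalerN, scaleNr) !opprK.
  - by rewrite scalerN scaleNr opprK.
  - by apply: memE xykS _; rewrite l1; vring.
  - by apply: memE xymS _; rewrite l1; vring.
  by rewrite !oppr_eq0 => /eqP-> /eqP; rewrite oppr_eq0 => /eqP->.
- rewrite l1 in xykS xymS.
  exact: (three_lines_aux f eS xS yS xyS xeS yeS xyeS xkS xykS xymS).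
(* For l = 0 the third line also lies over y, so it is the first line, which
   then has four points and three directions in common with the second. *)
rewrite l0 subr0 in xymS; rewrite l0 addr0 in xykS.
have yeS0 : y + 0 *: e \in S by rewrite scale0r addr0.
have [|k0 _] := unique_line_over f eS xS yS xyS xkS yeS0.
  by apply: memE xykS _; vring.
have yNS : - y \in S by rewrite symS.
have xmyS : x - y \in S by apply: memE xymS _; rewrite k0; vring.
have f' : free [:: e; x; - y].
  by apply: (free_comb (M := fun i j k => (i, j, - k)) f) => [*|]; [vring|f3enum].
have [||-> /eqP] := @unique_line_over e x (- y) i (- j) f' eS xS yNS xmyS xeS.
- by apply: memN yeS _; vring.
- by apply: memE xyeS _; vring.
by rewrite oppr_eq0 => /eqP.
Qed.
End NoConfiguration.
End Plane.

(** * Counting pairs of points on long lines *)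

Section Counting.
Local Open Scope ring_scope.
Variable m : nat.
Notation V := 'cV['F_3]_m.
Implicit Types (S : {set V}) (a b c x y z w : V) (d : V * V).

(** Two different points (up to sign) whose line has a third point: the other two
    points of the projective line are x + y and x - y. *)
Definition long_pair S x y :=
  [&& x \in S, y \in S, y != x, y != - x & (x + y \in S) || (x - y \in S)].

Definition projection S (pi : 'End(V)) : {set V} := [set pi x | x in S] :\ 0.

Lemma F3_double (x : V) : x + x = - x.
Proof. by vec3. Qed.

Lemma eq_opp0 (x : V) : (x == - x) = (x == 0).
Proof.
apply/eqP/eqP=> [E|->]; last by rewrite oppr0.
have: x + x = 0 by rewrite {2}E subrr.
by rewrite F3_double => /eqP; rewrite oppr_eq0 => /eqP.
Qed.

(** For d = (pi x, pi y) this says that the line through x and y avoids the centre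
    of the projection pi. *)
Definition generic d := [&& d.1 != 0, d.2 != 0, d.2 != d.1 & d.2 != - d.1].

(** The two remaining points of the line through d.1 and d.2. *)
Definition other_pair d := (d.1 + d.2, d.1 - d.2).

Lemma other_pairK d : other_pair (other_pair d) = (- d.1, - d.2).
Proof.
by case: d => x y; rewrite /other_pair /=; congr pair; vec3.
Qed.

Lemma other_pair_inj : injective other_pair.
Proof.
move=> [a b] [a' b'] E; have := congr1 other_pair E.
by rewrite !other_pairK /= => -[/oppr_inj-> /oppr_inj->].
Qed.

Lemma generic_other d : generic d -> generic (other_pair d).
Proof.
case: d => x y; rewrite /generic /= => /and4P[x0 y0 yx yNx].
rewrite addr_eq0 subr_eq0 -[x == y]eq_sym -[x == - y]eq_sym eqr_oppLR yx yNx /=.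
apply/andP; split; apply/eqP=> E.
  case/eqP: y0; rewrite (_ : y = (x - y) - (x + y)); last by vec3.
  by rewrite E subrr.
case/eqP: x0; rewrite (_ : x = - (x + y) - (x - y)); last by vec3.
by rewrite E subrr.
Qed.

Lemma long_pairC S x y : symmetric_set S -> long_pair S x y = long_pair S y x.
Proof.
move=> symS; rewrite /long_pair [x == y]eq_sym [x == - y]eq_sym eqr_oppLR.
by rewrite [x + y]addrC -[x - y]opprB symS; case: (x \in S); case: (y \in S).
Qed.

Lemma long_pairNr S x y : symmetric_set S -> long_pair S x (- y) = long_pair S x y.
Proof.
move=> symS; rewrite /long_pair symS eqr_oppLR eqr_opp opprK.
by rewrite orbC; case: (y == x); case: (y == - x).
Qed.

Lemma long_pairNN S x y : symmetric_set S -> long_pair S (- x) (- y) = long_pair S x y.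
Proof. by move=> symS; rewrite long_pairNr // long_pairC // long_pairNr // long_pairC. Qed.

Definition npairs S := #|[set xy : V * V | long_pair S xy.1 xy.2]|.

Section Projection.
Variables (S : {set V}) (e : V) (pi : 'End(V)).
Hypotheses (S_free : K4P7_free S) (eS : e \in S).
Hypothesis ker_pi : forall x, pi x = 0 -> exists t : 'F_3, x = t *: e.
Hypothesis pi_e : pi e = 0.

Let symS : symmetric_set S. Proof. by case: S_free. Qed.
Let S' := projection S pi.

Let memN x y : x \in S -> y = - x -> y \in S.
Proof. by move=> xS ->; rewrite symS. Qed.

Let e0 : e != 0.
Proof. by apply: contraTneq eS => ->; case: S_free. Qed.

Let same_fibre x y : pi x = pi y -> exists t : 'F_3, y = x + t *: e.
Proof.
move=> E; have [|t Et] := ker_pi (x := y - x); first by rewrite linearB /= E subrr.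
by exists t; rewrite -Et addrC subrK.
Qed.

Let gen_free x y : generic (pi x, pi y) -> free [:: e; x; y].
Proof.
case/and4P=> /= x0 y0 yx yNx; apply/free3P=> i j k E.
have {}: j *: pi x + k *: pi y = 0.
  by have := congr1 pi E; rewrite !linearD !linearZ /= pi_e scaler0 add0r linear0.
move=> Exy; suff [j0 k0] : j = 0 /\ k = 0.
  split=> //; move: E; rewrite j0 k0 !scale0r !addr0 => /eqP.
  by rewrite scaler_eq0 (negPf e0) orbF => /eqP.
move: Exy x0 y0 yx yNx.
case: (F3P j) => ->; case: (F3P k) => ->;
  rewrite ?(scale0r, scale1r, scaleN1r, add0r, addr0) //.
- by move=> ->; rewrite eqxx.
- by move=> /eqP; rewrite oppr_eq0 => ->.
- by move=> ->; rewrite eqxx.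
- by move=> /eqP; rewrite addrC addr_eq0 => ->.
- by move=> /eqP; rewrite subr_eq0 eq_sym => ->.
- by move=> /eqP; rewrite oppr_eq0 => ->.
- by move=> /eqP; rewrite addrC subr_eq0 => ->.
by move=> /eqP; rewrite addrC addr_eq0 opprK eqr_oppLR => ->.
Qed.

(* Lines over d.1, d.2 and d.1 + d.2, and over d.1, d.2 and d.1 - d.2. *)
Let Fp d := [set xy : V * V | [&& xy.1 \in S, xy.2 \in S, xy.1 + xy.2 \in S,
                                  pi xy.1 == d.1 & pi xy.2 == d.2]].
Let Fm d := [set xy : V * V | [&& xy.1 \in S, xy.2 \in S, xy.1 - xy.2 \in S,
                                  pi xy.1 == d.1 & pi xy.2 == d.2]].
Let f d := #|[set xy | long_pair S xy.1 xy.2 & (pi xy.1, pi xy.2) == d]|.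
Let g d := long_pair S' d.1 d.2.

Let f_sub d : (f d <= #|Fp d :|: Fm d|)%N.
Proof.
apply/subset_leq_card/subsetP=> -[x y]; rewrite !inE /= => /andP[].
by case/and5P=> -> -> _ _ + /eqP<-; rewrite !eqxx !andbT.
Qed.

Let Fp_le1 d : generic d -> (#|Fp d| <= 1)%N.
Proof.
case: d => d1 d2 gd; apply/card_le1_eqP=> -[x y] [x' y']; rewrite !inE /=.
case/and5P=> xS yS xyS /eqP Ex /eqP Ey; case/and5P=> xS' yS' xyS' /eqP Ex' /eqP Ey'.
have [t Et] : exists t, x' = x + t *: e by apply: same_fibre; rewrite Ex.
have [s Es] : exists s, y' = y + s *: e by apply: same_fibre; rewrite Ey.
have fr : free [:: e; x; y] by apply: gen_free; rewrite Ex Ey.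
rewrite Et Es in xS' yS' xyS' *.
have [-> ->] := unique_line_over S_free fr eS xS yS xyS xS' yS' xyS'.
by rewrite !scale0r !addr0.
Qed.

Let genericN d : generic d -> generic (d.1, - d.2).
Proof.
case: d => d1 d2 /and4P[/= x0 y0 yx yNx]; rewrite /generic /= x0 oppr_eq0 y0.
by rewrite eqr_oppLR yNx eqr_opp yx.
Qed.

Let Fm_le1 d : generic d -> (#|Fm d| <= 1)%N.
Proof.
case: d => d1 d2 gd; apply: leq_trans (Fp_le1 (genericN gd)).
have inj : injective (fun xy : V * V => (xy.1, - xy.2)).
  by move=> [x y] [x' y'] /= [-> /oppr_inj->].
rewrite -(card_imset _ inj); apply/subset_leq_card/subsetP=> _ /imsetP[[x y] xyF ->].
move: xyF; rewrite !inE /= => /and5P[-> yS -> -> /eqP<-].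
by rewrite symS yS linearN eqxx.
Qed.

Let memS' x : x \in S -> pi x != 0 -> pi x \in S'.
Proof. by move=> zS z0; rewrite !inE z0 imset_f. Qed.

Lemma sym_proj : symmetric_set S'.
Proof.
have sub x : x \in S' -> - x \in S'.
  rewrite !inE oppr_eq0 => /andP[-> /imsetP[y yS ->]].
  by apply/imsetP; exists (- y); rewrite ?symS ?linearN.
by move=> x; apply/idP/idP=> [/sub|/sub//]; rewrite opprK.
Qed.

Let f_pos d : generic d -> (0 < f d)%N -> g d.
Proof.
case: d => d1 d2 gd; case/card_gt0P=> -[x y]; rewrite inE /= => /andP[].
case/and5P=> xS yS _ _ xyS /eqP[Ex Ey]; case/and4P: gd => /= d10 d20 d21 dN.
have d1S : d1 \in S' by rewrite -Ex memS' ?Ex.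
have d2S : d2 \in S' by rewrite -Ey memS' ?Ey.
rewrite /g /long_pair /= d1S d2S d21 dN /=; apply/orP.
case/orP: xyS => H; [left | right].
  have Exy : pi (x + y) = d1 + d2 by rewrite linearD /= Ex Ey.
  by rewrite -Exy memS' // Exy addrC addr_eq0.
have Exy : pi (x - y) = d1 - d2 by rewrite linearB /= Ex Ey.
by rewrite -Exy memS' // Exy subr_eq0 eq_sym.
Qed.

Let f_gt1 d : generic d -> (1 < f d)%N -> exists xy xy',
  [/\ xy \in Fp d, xy' \in Fm d & xy != xy'].
Proof.
move=> gd /leq_trans/(_ (f_sub d)) lt1.
have [xy xyF|Fp0] := pickP (mem (Fp d)); last first.
  have E0 : Fp d = set0 by apply/setP=> xy; rewrite in_set0; apply: Fp0.
  by rewrite E0 set0U in lt1; have := leq_trans lt1 (Fm_le1 gd).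
have [xy' xyF'|Fm0] := pickP (mem (Fm d)); last first.
  have E0 : Fm d = set0 by apply/setP=> xy'; rewrite in_set0; apply: Fm0.
  by rewrite E0 setU0 in lt1; have := leq_trans lt1 (Fp_le1 gd).
exists xy, xy'; split=> //; apply/eqP=> E.
have sub : Fp d :|: Fm d \subset [set xy].
  apply/subsetP=> z; rewrite in_setU in_set1 => /orP[zF|zF].
    by rewrite (card_le1_eqP (Fp_le1 gd) _ _ zF xyF).
  by rewrite E (card_le1_eqP (Fm_le1 gd) _ _ zF xyF').
by have := leq_trans lt1 (subset_leq_card sub); rewrite cards1.
Qed.

Let f_gt1_other d : generic d -> (1 < f d)%N -> g (other_pair d).
Proof.
case: d => d1 d2 gd /(f_gt1 gd)[[x y] [[x' y']]]; rewrite !inE /=.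
case=> /and5P[xS yS xyS /eqP Ex /eqP Ey] /and5P[xS' yS' xyS' /eqP Ex' /eqP Ey'] _.
have /and4P[/= d10 d20 d21 dN] := generic_other gd.
have Exy : pi (x + y) = d1 + d2 by rewrite linearD /= Ex Ey.
have Exy' : pi (x' - y') = d1 - d2 by rewrite linearB /= Ex' Ey'.
have d1S : d1 + d2 \in S' by rewrite -Exy memS' ?Exy.
have d2S : d1 - d2 \in S' by rewrite -Exy' memS' ?Exy'.
have ENx : pi (- x) = d1 + d2 + (d1 - d2).
  by rewrite addrACA subrr addr0 F3_double linearN /= Ex.
rewrite /g /long_pair /= d1S d2S d21 dN /= -ENx memS' ?symS //.
by rewrite linearN /= Ex oppr_eq0; case/and4P: gd.
Qed.

(* Two points of the fibre over d come from two lines that miss different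
   directions; a point of the fibre over the other pair would come from a third. *)
Let f_gt1_disjoint d : generic d -> (1 < f d)%N -> f (other_pair d) = 0%N.
Proof.
case: d => d1 d2 gd /(f_gt1 gd)[[x y] [[x' y']]]; rewrite !inE /=.
case=> /and5P[xS yS xyS /eqP Ex /eqP Ey] /and5P[xS' yS' xyS' /eqP Ex' /eqP Ey'] ne.
apply/eqP; rewrite cards_eq0; apply/eqP/setP=> -[z w]; rewrite !inE /=.
apply/negP=> /andP[/and5P[zS wS _ _ zwS] /eqP[Ez Ew]].
have [i Ei] : exists t, x' = x + t *: e by apply: same_fibre; rewrite Ex.
have [j Ej] : exists s, y' = y + s *: e by apply: same_fibre; rewrite Ey.
have [k Ek] : exists t, z = x + y + t *: e.
  by apply: same_fibre; rewrite linearD /= Ex Ey.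
have [l El] : exists t, w = x - y + t *: e.
  by apply: same_fibre; rewrite linearB /= Ex Ey.
have fr : free [:: e; x; y] by apply: gen_free; rewrite Ex Ey.
have fr' : free [:: e; y; x] by rewrite free3_swap.
have yxS : y + x \in S by rewrite addrC.
case/negP: ne; suff [i0 j0] : i = 0 /\ j = 0.
  by rewrite Ei Ej i0 j0 !scale0r !addr0.
rewrite {}Ei {}Ej {}Ek {}El in xS' yS' xyS' zS wS zwS.
(* In characteristic three, -2 = 1. *)
have tr (t : 'F_3) : - t - t = t by case: (F3P t) => ->; apply: val_inj.
have trV (v : V) : v = - v - v by vec3.
have kl : (- k - l) + (l - k) = k by rewrite -[RHS]tr; ring.
have lk : (- k - l) - (l - k) = l by rewrite -[RHS]tr; ring.
case/orP: zwS => zwS.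
- apply: (three_lines_over S_free (k := - k - l) (l := l - k) fr eS xS yS xyS xS' yS' xyS').
  + apply: memN zwS _; rewrite {1}(trV x); vring.
  + by rewrite kl; exact: zS.
  by rewrite lk; exact: wS.
have [||||->->//] :=
  @three_lines_over _ _ S_free e y x j i (l - k) (- k - l) fr' eS yS xS yxS yS' xS'.
- by rewrite -symS opprB; exact: xyS'.
- by apply: memN zwS _; rewrite {1}(trV y); vring.
- by rewrite [_ + (- k - l)]addrC kl [y + x]addrC; exact: zS.
by apply: memN wS _; rewrite -[l - k - _]opprB lk; vring.
Qed.

Let f_le2 d : generic d -> (f d <= 2)%N.
Proof.
move=> gd; apply: leq_trans (f_sub d) _; rewrite cardsU.
by apply: leq_trans (leq_subr _ _) _; rewrite (leq_add (Fp_le1 gd) (Fm_le1 gd)).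
Qed.

Let f_opp d : (0 < f d)%N -> (0 < f (- d.1, - d.2))%N.
Proof.
case: d => d1 d2 /card_gt0P[[x y]]; rewrite inE /= => /andP[axy /eqP[Ex Ey]].
apply/card_gt0P; exists (- x, - y); rewrite inE /= !linearN /= Ex Ey eqxx andbT.
by rewrite long_pairNN.
Qed.

(** Both fibres together count the lines over the plane of d that avoid e, each with
    weight its number of points minus two. A fibre with two elements forces all
    four directions to be occupied and the opposite fibre to be empty; so the
    fibres never exceed, in total, the number of image pairs. *)
Lemma fibre_pair d : generic d ->
  (f d + f (other_pair d) <= g d + g (other_pair d))%N.
Proof.
move=> gd; have gd' := generic_other gd; have gd'' := generic_other gd'.
have f1 d' : generic d' -> (f d' <= 1)%N -> (f d' <= g d')%N.
  by move=> gen; have := f_pos gen; case: (f d') => [|[|//]] //= ->.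
have f2 d' : generic d' -> (1 < f d')%N -> f d' = 2.
  by move=> gen lt; apply/eqP; rewrite eqn_leq f_le2.
have [le1|gt1] := leqP (f d) 1; last first.
  by rewrite (f_gt1_disjoint gd gt1) (f2 _ gd gt1) (f_gt1_other gd gt1) (f_pos gd) // ltnW.
have [le1'|gt1'] := leqP (f (other_pair d)) 1; first by rewrite leq_add ?f1.
have f0 : f d = 0%N.
  apply/eqP; rewrite -leqn0 leqNgt; apply/negP=> /f_opp.
  by rewrite -other_pairK (f_gt1_disjoint gd' gt1').
rewrite f0 (f2 _ gd' gt1') (f_pos gd') ?(ltnW gt1') // addn1.
have := f_gt1_other gd' gt1'; rewrite other_pairK /g /= long_pairNN => [->//|x].
exact: sym_proj.
Qed.

Let generic_otherE d : generic (other_pair d) = generic d.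
Proof.
apply/idP/idP=> [|/generic_other//]; move/generic_other; rewrite other_pairK.
by case: d => d1 d2; rewrite /generic /= !oppr_eq0 eqr_opp eqr_opp.
Qed.

(** Summing fibre_pair over all d counts every fibre twice, because other_pair is a
    bijection. *)
Lemma generic_pairs :
  (#|[set xy | long_pair S xy.1 xy.2 & generic (pi xy.1, pi xy.2)]| <= npairs S')%N.
Proof.
pose X := (\sum_(d | generic d) f d)%N; pose Y := (\sum_(d | generic d) g d)%N.
have -> : #|[set xy | long_pair S xy.1 xy.2 & generic (pi xy.1, pi xy.2)]| = X.
  rewrite -sum1_card (partition_big (fun xy => (pi xy.1, pi xy.2)) generic).
    apply: eq_bigr => d gd; rewrite /f -sum1_card; apply: eq_bigl => xy.
    rewrite !inE; case: eqP => [->|]; last by rewrite !andbF.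
    by rewrite gd !andbT.
  by move=> xy; rewrite inE => /andP[].
have leY : (Y <= npairs S')%N.
  rewrite /Y /npairs -sum1_card [leqRHS]big_mkcond [leqLHS]big_mkcond /=.
  by apply: leq_sum => d _; rewrite inE /g; case: (generic d); case: (long_pair _ _ _).
apply: leq_trans leY; rewrite -leq_double -!addnn.
have E (h : V * V -> nat) :
    (\sum_(d | generic d) h d = \sum_(d | generic d) h (other_pair d))%N.
  by rewrite (reindex_inj other_pair_inj); apply: eq_bigl => d; apply: generic_otherE.
rewrite {2}/X {2}/Y (E f) (E g) -!big_split /=.
by apply: leq_sum => d; apply: fibre_pair.
Qed.

Let fibre (d : V) := [set y in S | pi y == d].
Let Sne := [set y in S | pi y != 0].

Let fibre_le3 (d : V) : (#|fibre d| <= 3)%N.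
Proof.
have [->|/set0Pn[x xF]] := eqVneq (fibre d) set0; first by rewrite cards0.
have sub : fibre d \subset [set x; x + e; x - e].
  apply/subsetP=> y; rewrite inE => /andP[_ /eqP Ey].
  move: xF; rewrite inE => /andP[_ /eqP Ex].
  have [t ->] : exists t : 'F_3, y = x + t *: e by apply: same_fibre; rewrite Ex.
  by rewrite !inE; case: (F3P t) => ->;
    rewrite ?scale0r ?addr0 ?scale1r ?scaleN1r eqxx ?orbT.
apply: leq_trans (subset_leq_card sub) _.
rewrite -setUA; apply: leq_trans (leq_card_setU _ _) _.
by rewrite cards1 ltnS; apply: leq_trans (leq_card_setU _ _) _; rewrite !cards1.
Qed.

Let pi0 x : x \in S -> (pi x == 0) = (x \in [set e; - e]).
Proof.
move=> xS; apply/eqP/set2P=> [/ker_pi[t Et]|[]->]; last 2 first.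
- exact: pi_e.
- by rewrite linearN /= pi_e oppr0.
case: (F3P t) Et => ->; rewrite ?scale0r ?scale1r ?scaleN1r => Et; [|by left|by right].
by case: S_free xS => _ /negP S0 _ _; rewrite Et.
Qed.

Let card_S : #|S| = (#|Sne| + 2)%N.
Proof.
rewrite -(cardsID [set e; - e] S) addnC; congr addn.
  apply: eq_card => x; rewrite inE [RHS]inE andbC.
  by case: (boolP (x \in S)) => //= xS; rewrite pi0.
rewrite (setIidPr _) ?cards2 1?eq_opp0 1?e0 //.
by apply/subsetP=> x /set2P[]->; rewrite ?symS.
Qed.

Let sum_fibres (h : nat -> nat) :
  (\sum_(y in Sne) h #|fibre (pi y)| = \sum_(d in S') #|fibre d| * h #|fibre d|)%N.
Proof.
rewrite (partition_big (fun y => pi y) (mem S')) /=; last first.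
  by move=> y; rewrite inE => /andP[yS y0]; apply: memS'.
apply: eq_bigr => d; rewrite !inE => /andP[d0 _].
rewrite -sum_nat_const; apply: eq_big => [y|y /andP[_ /eqP->] //].
by rewrite !inE; case: (pi y =P d) => [->|]; rewrite ?andbF // d0 !andbT.
Qed.

Let D := [set y | long_pair S e y].

Let card_D : (#|D| <= \sum_(y in Sne) (1 < #|fibre (pi y)|))%N.
Proof.
rewrite -sum1_card big_mkcond [leqRHS]big_mkcond /=; apply: leq_sum => y _.
rewrite [in X in (X <= _)%N]inE; case: ifP => // /and5P[_ yS ye yNe yeS].
rewrite inE yS pi0 // !inE negb_or ye yNe /=.
suff [z zF zy] : exists2 z, z \in fibre (pi y) & z != y.
  rewrite (cardD1 y) inE yS eqxx (cardD1 z) inE zy /=.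
  by move: zF; rewrite inE => ->.
case/orP: yeS => H.
  exists (e + y); first by rewrite inE H linearD /= pi_e add0r eqxx.
  by rewrite -subr_eq0 addrK e0.
exists (y - e); first by rewrite inE -symS opprB H linearB /= pi_e subr0 eqxx.
by rewrite -subr_eq0 addrC addKr oppr_eq0 e0.
Qed.

Let A3 := [set xy | [&& long_pair S xy.1 xy.2, pi xy.1 != 0 & pi xy.2 == pi xy.1]].

Let card_A3 : (#|A3| <= \sum_(y in Sne) (#|fibre (pi y)| - 1))%N.
Proof.
rewrite -sum1_card (partition_big (fun xy => xy.1) (mem Sne)) /=; last first.
  by move=> [x y]; rewrite !inE /= => /and3P[/and5P[-> _ _ _ _] -> _].
apply: leq_sum => x xS; rewrite sum1_card.
have inj : injective (fun y : V => (x, y)) by move=> y y' [].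
have xF : x \in fibre (pi x) by move: xS; rewrite !inE eqxx => /andP[->].
rewrite (cardsD1 x (fibre _)) xF add1n subn1 /= -(card_imset _ inj).
apply/subset_leq_card/subsetP=> -[x' y] /andP[]; rewrite inE /=.
case/and3P=> /and5P[_ yS yx _ _] _ Ey /eqP Ex; rewrite Ex in yx Ey.
by rewrite Ex; apply/imsetP; exists y => //; rewrite !inE yx yS Ey.
Qed.

(** A fibre with c elements accounts for all the pairs on one half of a line through
    e: the point e is paired with each y of the fibre (four pairs, up to order and
    sign of e, when c > 1), and y with the other elements of the fibre and their
    opposites. The total c (4 [c > 1] + 2 (c - 1)) equals 12 (c - 1) for c = 1, 2, 3,
    and the sum of c over the fibres is #|S| - 2. *)
Lemma nongeneric_pairs :
  (#|[set xy | long_pair S xy.1 xy.2 & ~~ generic (pi xy.1, pi xy.2)]| + 12 * #|S'| + 24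
     <= 12 * #|S|)%N.
Proof.
set N := [set xy | _ & _].
pose A1 := setX [set e; - e] D; pose A2 := setX D [set e; - e].
pose A4 := [set (xy.1, - xy.2) | xy in A3].
have adjN y : long_pair S (- e) y = long_pair S e y.
  by rewrite long_pairC // long_pairNr // long_pairC.
have subN : N \subset (A1 :|: A2) :|: (A3 :|: A4).
  apply/subsetP=> -[x y]; rewrite inE /= => /andP[axy].
  have [_ yS _ _ _] := and5P axy; have [xS _ _ _ _] := and5P axy.
  rewrite in_setU in_setU !in_setX /generic /= !negb_and !negbK pi0 // pi0 //.
  have [xe|xe] /= := boolP (x \in [set e; - e]).
    by case/set2P: xe axy => ->; rewrite ?adjN inE => ->.
  have [ye|ye] /= := boolP (y \in [set e; - e]).
    by case/set2P: ye axy => ->; rewrite ?long_pairNr // long_pairC // inE => ->.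
  rewrite !andbF /= in_setU; case/orP=> [yx|yNx].
    by rewrite inE /= axy pi0 // xe yx.
  apply/orP; right; apply/imsetP; exists (x, - y); last by rewrite /= opprK.
  by rewrite inE /= long_pairNr // axy pi0 // xe linearN /= eqr_oppLR yNx.
have le4 : (#|A4| <= #|A3|)%N by apply: leq_imset_card.
have le1 : (#|A1| <= 2 * #|D|)%N.
  by rewrite cardsX leq_mul // cards2; case: (_ != _).
have le2 : (#|A2| <= 2 * #|D|)%N.
  by rewrite cardsX mulnC leq_mul // cards2; case: (_ != _).
have leN : (#|N| <= 4 * #|D| + 2 * #|A3|)%N.
  apply: leq_trans (subset_leq_card subN) _; apply: leq_trans (leq_card_setU _ _) _.
  apply: leq_trans (leq_add (leq_card_setU _ _) (leq_card_setU _ _)) _.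
  apply: leq_trans (leq_add (leq_add le1 le2) (leq_add (leqnn _) le4)) _.
  have E (a b : nat) : (2 * a + 2 * a + (b + b) <= 4 * a + 2 * b)%N by lia.
  exact: E.
rewrite card_S mulnDr leq_add2r.
have -> : #|Sne| = (\sum_(d in S') #|fibre d|)%N.
  by rewrite -sum1_card (sum_fibres (fun=> 1%N)); apply: eq_bigr => d _; rewrite muln1.
apply: leq_trans (_ : \sum_(d in S')
  (#|fibre d| * (4 * (1 < #|fibre d|) + 2 * (#|fibre d| - 1)) + 12) <= _)%N; last first.
  rewrite big_distrr /=; apply: leq_sum => d; rewrite !inE => /andP[_ /imsetP[y yS Ey]].
  have : (0 < #|fibre d|)%N by apply/card_gt0P; exists y; rewrite inE yS Ey eqxx.
  by have := fibre_le3 d; case: #|_| => [|[|[|[|n]]]].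
rewrite big_split /= sum_nat_const [(#|S'| * _)%N]mulnC leq_add2r.
rewrite -(sum_fibres (fun c : nat => 4 * (1 < c) + 2 * (c - 1))%N).
rewrite big_split /= -!big_distrr /=.
by apply: leq_trans leN _; rewrite leq_add // leq_mul2l ?card_D ?card_A3.
Qed.

Lemma npairs_projection : (npairs S + 12 * #|S'| + 24 <= npairs S' + 12 * #|S|)%N.
Proof.
have := generic_pairs; have := nongeneric_pairs.
suff -> : npairs S =
  (#|[set xy | long_pair S xy.1 xy.2 & generic (pi xy.1, pi xy.2)]| +
   #|[set xy | long_pair S xy.1 xy.2 & ~~ generic (pi xy.1, pi xy.2)]|)%N by lia.
rewrite /npairs -(cardsID [set xy | generic (pi xy.1, pi xy.2)]).
by congr addn; apply: eq_card => xy; rewrite !inE // andbC.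
Qed.
End Projection.

(** Each projection lowers 12 #|S| - npairs S by at least 24, and the empty set is
    reached at the end. *)
Lemma pair_bound (P : {set V} -> Prop) :
  (forall S, P S -> K4P7_free S) ->
  (forall S e, P S -> e \in S -> exists pi : 'End(V),
     [/\ pi e = 0, forall x, pi x = 0 -> exists t, x = t *: e & P (projection S pi)]) ->
  forall S, P S -> S != set0 -> (npairs S < 12 * #|S|)%N.
Proof.
move=> Pclean Pproj S; have [n] := ubnP #|S|; elim: n S => // n IHn S ltn PS.
case/set0Pn=> e eS; have [pi [pi_e ker_pi PS']] := Pproj S e PS eS.
have bound := npairs_projection (Pclean S PS) eS ker_pi pi_e.
have [S'0|S'n0] := eqVneq (projection S pi) set0.
  suff E0 : npairs (projection S pi) = 0%N by move: bound; rewrite E0; lia.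
  by apply: eq_card0 => xy; rewrite !inE /long_pair S'0 inE.
have ltS' : (#|projection S pi| < #|S|)%N.
  rewrite [X in (_ < X)%N](cardsD1 e) eS add1n ltnS.
  apply: leq_trans _ (leq_imset_card pi _); apply/subset_leq_card/subsetP=> d.
  rewrite !inE => /andP[d0 /imsetP[x xS dE]]; rewrite dE; apply: imset_f.
  by rewrite !inE xS andbT; apply: contraNneq d0 => xe; rewrite dE xe pi_e.
by have := IHn _ (leq_trans ltS' ltn) PS' S'n0; lia.
Qed.
End Counting.

(** * Independent families of vectors *)

Section Families.
Local Open Scope ring_scope.
Variables (F : fieldType) (vT : vectType F).

Lemma span_familyP (T : finType) (v : T -> vT) (X : {set T}) w :
  reflect (exists c : T -> F, w = \sum_(x in X) c x *: v x)
          (w \in <<[seq v x | x <- enum X]>>%VS).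
Proof.
rewrite span_def big_map big_enum; apply: (iffP memv_sumP) => [[vs vsP ->]|[c ->]].
  have /fin_all_exists[c Ec] x : exists k, x \in X -> vs x = k *: v x.
    have [xX|_] := boolP (x \in X); last by exists 0.
    by have /vlineP[k Ek] := vsP x xX; exists k.
  by exists c; apply: eq_bigr => x xX; apply: Ec.
by exists (fun x => c x *: v x) => // x _; apply/memvZ/memv_line.
Qed.

Lemma free_familyP (T : finType) (v : T -> vT) (X : {set T}) :
  reflect (forall c : T -> F, \sum_(x in X) c x *: v x = 0 ->
             forall x, x \in X -> c x = 0)
          (free_family v X).
Proof.
suff E : free_family v X <-> forall c : T -> F, \sum_(x in X) c x *: v x = 0 ->
             forall x, x \in X -> c x = 0 by apply: (iffP idP) => /E.
have [n] := ubnP #|X|; elim: n X => // n IHn X ltXn.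
have [->|/set0Pn[e eX]] := eqVneq X set0.
  by rewrite free_family0; split=> // _ c _ x; rewrite inE.
rewrite -(setD1K eX) free_familyU1 ?setD11 //; set Y := X :\ e.
have ltY : (#|Y| < n)%N by move: ltXn; rewrite (cardsD1 e) eX.
have eY : e \notin Y by rewrite setD11.
split=> [/andP[/span_familyP eN /(IHn _ ltY) fY] c|H].
  rewrite big_setU1 //= => E.
  have ce : c e = 0.
    apply/eqP/negPn/negP=> ce; case: eN; exists (fun x => - (c e)^-1 * c x).
    rewrite (eq_bigr (fun x => - (c e)^-1 *: (c x *: v x))) => [|x _]; last first.
      by rewrite scalerA.
    move/eqP: E; rewrite addrC addr_eq0 => /eqP E.
    by rewrite -scaler_sumr E scaleNr scalerN opprK scalerA mulVf ?scale1r.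
  move: E; rewrite ce scale0r add0r => /fY cY x /setU1P[->//|]; exact: cY.
apply/andP; split.
  apply/span_familyP=> -[c Ec].
  have E : forall x, x \in Y -> (x == e) = false.
    by move=> x xY; apply: contraNF eY => /eqP<-.
  have := H (fun x => if x == e then -1 else c x).
  rewrite big_setU1 //= eqxx (eq_bigr (fun x => c x *: v x)) => [|x /E->//].
  rewrite -Ec scaleN1r addNr => /(_ erefl e); rewrite setU11 eqxx => /(_ isT)/eqP.
  by rewrite oppr_eq0 oner_eq0.
apply/(IHn _ ltY) => c Ec x xY.
have E : forall x, x \in Y -> (x == e) = false.
  by move=> z zY; apply: contraNF eY => /eqP<-.
have := H (fun x => if x == e then 0 else c x).
rewrite big_setU1 //= eqxx scale0r add0r (eq_bigr (fun x => c x *: v x)) => [|z /E->//].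
by move=> /(_ Ec x); rewrite inE xY orbT E // => /(_ isT).
Qed.

Lemma free_family_imset (T T' : finType) (v : T -> vT) (g : T' -> T) (Y : {set T'}) :
  {in Y &, injective g} -> free_family v (g @: Y) = free_family (v \o g) Y.
Proof.
move=> inj; rewrite /free_family (map_comp v g).
apply: perm_free; apply: perm_map; apply: uniq_perm.
- exact: enum_uniq.
- by rewrite map_inj_in_uniq ?enum_uniq // => x y; rewrite !mem_enum; apply: inj.
move=> x; rewrite mem_enum; apply/imsetP/mapP=> -[y yY ->]; exists y => //.
  by rewrite mem_enum.
by rewrite mem_enum in yY.
Qed.

Lemma free_family_sign (T : finType) (v w : T -> vT) (X : {set T}) :
  (forall x, x \in X -> w x = v x \/ w x = - v x) ->
  free_family w X = free_family v X.
Proof.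
suff H (a b : T -> vT) : (forall x, x \in X -> b x = a x \/ b x = - a x) ->
    free_family a X -> free_family b X.
  move=> wv; apply/idP/idP; apply: H => // x /wv[->|->]; first by left.
  by right; rewrite opprK.
move=> ba /free_familyP fa; apply/free_familyP=> c E x xX.
pose s x := if b x == a x then 1 else -1 : F.
have /fa/(_ x xX)/eqP : \sum_(x in X) (c x * s x) *: a x = 0.
  rewrite -[RHS]E; apply: eq_bigr => y /ba ya; rewrite -scalerA /s.
  by case: eqP ya => [-> _|ne [|->]]; rewrite ?scale1r ?scaleN1r.
rewrite mulf_eq0 /s => /orP[/eqP//|].
by case: ifP; rewrite ?oppr_eq0 oner_eq0.
Qed.

End Families.

Section LinearImages.
Local Open Scope ring_scope.

Lemma free_family_linear (F : fieldType) (U W : vectType F) (T : finType)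
    (L : {linear U -> W}) (v : T -> U) (X : {set T}) :
  injective L -> free_family (L \o v) X = free_family v X.
Proof.
move=> injL; apply/free_familyP/free_familyP=> H c E; apply: H.
  have := congr1 L E; rewrite linear0 linear_sum => EL; rewrite -[RHS]EL.
  by apply: eq_bigr => x _; rewrite linearZ.
apply: injL; rewrite linear0 -[RHS]E linear_sum; apply: eq_bigr => x _.
by rewrite linearZ.
Qed.

(** Contraction of C is projection along the span of C. *)
Lemma free_family_quotient (F : fieldType) (U W : vectType F) (T : finType)
    (v : T -> U) (p : 'Hom(U, W)) (C X : {set T}) :
  free_family v C -> lker p = <<[seq v x | x <- enum C]>>%VS -> [disjoint X & C] ->
  free_family v (X :|: C) = free_family (p \o v) X.
Proof.
move=> fC kerp dXC.
have bigXC (h : T -> U) :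
    \sum_(x in X :|: C) h x = \sum_(x in X) h x + \sum_(x in C) h x.
  by rewrite -bigU //; apply: eq_bigl => x; rewrite !inE.
apply/free_familyP/free_familyP=> H c E.
  have /span_familyP[c' Ec'] :
      \sum_(x in X) c x *: v x \in <<[seq v x | x <- enum C]>>%VS.
    rewrite -kerp memv_ker linear_sum /= -[X in _ == X]E; apply/eqP/eq_bigr=> x _.
    by rewrite linearZ.
  pose c1 x := if x \in X then c x else - c' x.
  have E1 : \sum_(x in X :|: C) c1 x *: v x = 0.
    rewrite bigXC (eq_bigr (fun x => c x *: v x)) => [|x]; last by rewrite /c1 => ->.
    rewrite Ec' -big_split big1 //= => x xC.
    by rewrite /c1 (disjointFl dXC xC) scaleNr subrr.
  by move=> x xX; have := H _ E1 x; rewrite inE xX /c1 xX => /(_ isT).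
have cX x : x \in X -> c x = 0.
  apply: H; rewrite bigXC in E; have := congr1 p E.
  rewrite linearD linear0 !linear_sum /= [X in _ + X]big1 ?addr0 => [EX|y yC].
    by rewrite -[RHS]EX; apply: eq_bigr => y _; rewrite linearZ.
  rewrite linearZ /=; have : v y \in lker p.
    by rewrite kerp memv_span // map_f // mem_enum.
  by rewrite memv_ker => /eqP->; rewrite scaler0.
move=> x; rewrite inE => /orP[/cX//|xC].
apply: (free_familyP _ _ fC) x xC.
by move: E; rewrite bigXC big1 ?add0r // => x /cX->; rewrite scale0r.
Qed.

End LinearImages.

(** * Cycle matroids are represented by differences of vectors *)

Section CycleRep.
Local Open Scope ring_scope.
Variables (F : fieldType) (vT : vectType F) (V : finType) (G : sgraph V).
Variables (u : V -> vT) (w : {set V} -> vT).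
Implicit Types (X : {set {set V}}) (e f : {set V}).
Hypothesis u_affine : forall a : V -> F, \sum_z a z = 0 ->
  \sum_z a z *: u z = 0 -> forall z, a z = 0.
Hypothesis w_edge : forall x y, x != y -> [set x; y] \in edges G ->
  w [set x; y] = u x - u y \/ w [set x; y] = u y - u x.

Let edgeP e : e \in edges G -> exists x y, [/\ x != y, e = [set x; y] & w e = u x - u y].
Proof.
move=> eG; have /eqP/cards2P[x [y [xy E]]] := edges_card2 eG.
rewrite {}E in eG *; have [Ew|Ew] := w_edge xy eG; first by exists x, y.
by exists y, x; rewrite eq_sym; split=> //; rewrite setUC.
Qed.

Let path_span X x p : X \subset edges G -> path (adj X) x p ->
  u x - u (last x p) \in <<[seq w e | e <- enum X]>>%VS.
Proof.
move=> sXG; elim: p x => [|y p IHp] x /=; first by rewrite subrr mem0v.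
case/andP=> xyX pp; rewrite -(subrK (u y) (u x)) -addrA memvD ?IHp //.
have [->|nxy] := eqVneq x y; first by rewrite subrr mem0v.
have : w [set x; y] \in <<[seq w e | e <- enum X]>>%VS.
  by apply: memv_span; apply: map_f; rewrite mem_enum.
by case: (w_edge nxy (subsetP sXG _ xyX)) => ->; rewrite // -opprB memvN.
Qed.

(* Along a cycle the differences telescope to zero, so an edge of a cycle is in the
   span of the other edges. *)
Let free_acyclic X : X \subset edges G -> free_family w X -> acyclic X.
Proof.
move=> sXG fX; apply/acyclicP=> -[|x p] // up cp; rewrite leqNgt.
apply/negP=> lt2p; pose y := last x p; pose e := [set x; y].
move: cp; rewrite /= rcons_path => /andP[pp ayx].
have eX : e \in X by rewrite /e setUC.
have xy : x != y.
  apply: contraTneq lt2p => Exy; case/andP: up; rewrite Exy.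
  by rewrite /y; case: (p) => //= a q; rewrite mem_last.
have pX : path (adj (X :\ e)) x p.
  case: p pp up lt2p @y @e ayx eX xy => [|a [|b q]] // pp up _ y e ayx eX xy.
  case/and3P: pp => xa ab pq; case/and3P: up => xN aN _.
  have za (z : V) : z \in [:: a, b & q] -> z != x by move=> zI; apply: contraNneq xN => <-.
  have ay : a != y by apply: contraNneq aN => ->; rewrite /y /= mem_last.
  have keep z t : [set z; t] \in X -> (z != x) && (t != x) -> [set z; t] \in X :\ e.
    move=> zt /andP[zx tx]; rewrite !inE zt andbT; apply/eqP=> /setP/(_ x).
    by rewrite !inE eqxx eq_sym (negPf zx) eq_sym (negPf tx).
  have qx : all (predC1 x) (b :: q).
    by apply/allP=> z zq /=; apply: za; rewrite inE zq orbT.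
  apply/and3P; split.
  - rewrite /adj /= in_setD1 [_ \in X]xa andbT; apply/eqP=> /setP/(_ a).
    rewrite !inE eqxx orbT (negPf ay) orbF => /esym/eqP E.
    by have := za a; rewrite E inE !eqxx => /(_ isT).
  - by apply: keep => //; rewrite !za // !inE eqxx ?orbT.
  apply: (sub_in_path (P := predC1 x) _ qx pq) => z t zx tx zt.
  by apply: keep => //; apply/andP.
move: fX; rewrite -(setD1K eX) free_familyU1 ?setD11 // => /andP[/negP eN _]; apply: eN.
have := path_span (subset_trans (subsetDl _ _) sXG) pX; rewrite -/y => H.
by case: (w_edge xy (subsetP sXG _ eX)) => ->; rewrite // -opprB memvN.
Qed.

(* Removing the edge e of a forest separates its ends. In a linear dependency, the
   sum of the coefficients of the vertices on one side receives a contribution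
   only from e, so the coefficient of e is zero. *)
Let acyclic_free X : X \subset edges G -> acyclic X -> free_family w X.
Proof.
move=> sXG /acyclicP aX; apply/free_familyP=> c E e eX.
have [x [y [xy Ee we]]] := edgeP (subsetP sXG _ eX).
pose Y := X :\ e; pose K := connect (adj Y) x.
have sym : connect_sym (adj Y) by apply/sym_connect_sym/adj_sym.
have yK : ~~ K y.
  apply/negP=> /connectP[p0 pp0]; case/shortenP: pp0 => p pp up _ Ey.
  have lt : (size (x :: p) <= 2)%N.
    apply: aX => //; rewrite /= rcons_path -Ey; apply/andP; split.
      by apply: sub_path pp => a b; rewrite /adj /= inE => /andP[].
    by rewrite /adj /= setUC -Ee.
  case: p pp up Ey lt => [|a [|//]] /=; first by move=> _ _ E1; rewrite E1 eqxx in xy.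
  by rewrite andbT /adj /= => ha _ Ey _; move: ha; rewrite -Ey -Ee setD11.
(* The boundary of an edge, as a function on the vertices. *)
have /fin_all_exists[b Hb] f : exists b : V -> F, f \in X ->
   [/\ w f = \sum_z b z *: u z, \sum_z b z = 0 &
       (\sum_(z | K z) b z == 0) = (f != e)].
  have [fX|_] := boolP (f \in X); last by exists (fun=> 0).
  have [s [t [st Ef wf]]] := edgeP (subsetP sXG _ fX).
  have sum_delta (W : lmodType F) (h : V -> W) (P : pred V) (r : V) :
      \sum_(z | P z) (z == r)%:R *: h z = (P r)%:R *: h r.
    rewrite big_mkcond (bigD1 r) //= eqxx big1 ?addr0 => [|z /negPf->].
      by case: (P r); rewrite ?scale0r.
    by rewrite scale0r if_same.
  exists (fun z => (z == s)%:R - (z == t)%:R) => _; split.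
  - under eq_bigr do rewrite scalerBl.
    by rewrite sumrB !(sum_delta _ _ xpredT) !scale1r.
  - rewrite sumrB; apply/eqP; rewrite subr_eq0; apply/eqP.
    have one (r : V) : \sum_z (z == r)%:R = 1 :> F.
      by rewrite (bigD1 r) //= eqxx big1 ?addr0 // => z /negPf->.
    by rewrite !one.
  have one (r : V) : \sum_(z | K z) (z == r)%:R = (K r)%:R :> F.
    rewrite big_mkcond (bigD1 r) //= eqxx big1 ?addr0 => [|z /negPf->].
      by case: (K r).
    by rewrite if_same.
  rewrite sumrB !one; have [fe|fe] /= := eqVneq f e.
    have Kx : K x by apply: connect0.
    have : s \in [set x; y] by rewrite -Ee -fe Ef set21.
    have : t \in [set x; y] by rewrite -Ee -fe Ef set22.
    case/set2P=> Et /set2P[] Es; move: st; rewrite ?Es ?Et ?eqxx //= Kx (negPf yK);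
      by rewrite ?subr0 ?sub0r ?oppr_eq0 oner_eq0.
  have Kst : K s = K t.
    apply: (same_connect_r sym); apply: connect1.
    by rewrite /adj /= !inE -Ef fe fX.
  by rewrite Kst subrr eqxx.
have E0 : \sum_z (\sum_(f in X) c f * b f z) *: u z = 0.
  rewrite -[RHS]E; under eq_bigr do rewrite scaler_suml.
  rewrite exchange_big; apply: eq_bigr => f /Hb[-> _ _].
  by rewrite scaler_sumr; apply: eq_bigr => z _; rewrite scalerA.
have S0 : \sum_z (\sum_(f in X) c f * b f z) = 0.
  rewrite exchange_big big1 // => f /Hb[_ bf _].
  by rewrite -mulr_sumr bf mulr0.
have a0 := u_affine S0 E0.
have : \sum_(z | K z) (\sum_(f in X) c f * b f z) = 0 by rewrite big1.
rewrite exchange_big (bigD1 e) //= [X in _ + X]big1 => [|f /andP[/Hb[_ _ bf] fe]].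
  rewrite addr0 -mulr_sumr => /eqP; have [_ _ be] := Hb e eX.
  by rewrite mulf_eq0 be eqxx orbF => /eqP.
by rewrite -mulr_sumr; move/eqP: bf; rewrite fe => /eqP/eqP->; rewrite mulr0.
Qed.

(** The orientation chosen for each edge is arbitrary, whence the disjunction in the
    assumption on w. *)
Lemma forest_free X : X \subset edges G -> forest G X = free_family w X.
Proof.
move=> sXG; rewrite /forest sXG /=.
by apply/idP/idP; [apply: acyclic_free | apply: free_acyclic].
Qed.
End CycleRep.

(** * Minors from projected vectors *)

Section Minors.
Local Open Scope ring_scope.
Variables (T : finType) (M : matroid T) (m : nat).
Notation V := 'cV['F_3]_m.
Variable v : T -> V.
Hypothesis indepE : forall X : {set T}, X \subset ground M ->
  indep M X = free_family v X.
Implicit Types (C X : {set T}) (p : 'End(V)).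

(** Zero is left out because it is the image of the loops of the contraction. Both
    signs are kept so that signs never have to be chosen. *)
Definition points p : {set V} :=
  [set y | (y != 0) && [exists x in ground M, (y == p (v x)) || (y == - p (v x))]].

Lemma pointsP p y :
  reflect (y != 0 /\ exists2 x, x \in ground M & y = p (v x) \/ y = - p (v x))
          (y \in points p).
Proof.
rewrite inE; apply: (iffP andP) => -[y0].
  move=> /exists_inP[x xM /orP yx]; split=> //; exists x => //.
  by case: yx => /eqP; [left|right].
case=> x xM yx; split=> //; apply/exists_inP; exists x => //.
by case: yx => ->; rewrite eqxx ?orbT.
Qed.

Definition contraction C p :=
  [/\ C \subset ground M, free_family v C & lker p = <<[seq v x | x <- enum C]>>%VS].

Lemma contract_indepE C p X : contraction C p -> X \subset ground M ->
  [disjoint X & C] -> indep (contract M C) X = free_family (p \o v) X.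
Proof.
case=> sCM fC kerp sXM dXC; rewrite -(free_family_quotient fC kerp dXC).
rewrite /= /contract_indep dXC /= -indepE; last by rewrite subUset sXM.
have iC : indep M C by rewrite indepE.
apply/existsP/idP=> [[B /andP[/maxsetP[/andP[sBC _] maxB] iXB]]|iXC].
  by rewrite (maxB C) // subxx.
exists C; rewrite iXC andbT; apply/maxsetP; split=> [|B /andP[sBC _] sCB].
  by rewrite subxx.
by apply/eqP; rewrite eqEsubset sBC.
Qed.

(** Parallel elements of the contraction have opposite or equal images, and one of
    each class is enough: the ground set of the minor consists of one preimage g j
    for each vector w j, and everything else is deleted. *)
Lemma minor_of_points (T' : finType) (N : matroid T') (w : T' -> V) C p :
  contraction C p -> ground N != set0 ->
  (forall Y : {set T'}, Y \subset ground N -> indep N Y = free_family w Y) ->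
  (forall j, j \in ground N -> w j \in points p) ->
  {in ground N &, forall j k, w j = w k \/ w j = - w k -> j = k} ->
  has_minor M N.
Proof.
move=> Cp /set0Pn[j0 j0N] indepN wp w_inj; have [sCM fC kerp] := Cp.
have /fin_all_exists[g Hg] j : exists x, j \in ground N ->
    x \in ground M /\ (w j = p (v x) \/ w j = - p (v x)).
  have [/wp/pointsP[_ [x xM wx]]|_] := boolP (j \in ground N); first by exists x.
  by have /pointsP[_ [x _ _]] := wp _ j0N; exists x.
have gM j : j \in ground N -> g j \in ground M by case/Hg.
have gw j : j \in ground N -> w j = p (v (g j)) \/ w j = - p (v (g j)) by case/Hg.
have gC j : j \in ground N -> g j \notin C.
  move=> jN; have /pointsP[wj0 _] := wp _ jN; apply: contraNN wj0 => gjC.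
  have : v (g j) \in lker p by rewrite kerp memv_span // map_f // mem_enum.
  by rewrite memv_ker => /eqP E; case: (gw _ jN) => ->; rewrite E ?oppr0.
have g_inj : {in ground N &, injective g}.
  move=> j k jN kN E; apply: w_inj => //.
  by case: (gw j jN) => ->; case: (gw k kN) => ->; rewrite E ?opprK; auto.
pose X0 := g @: ground N.
pose f x := odflt j0 [pick j in ground N | g j == x].
have gK : {in ground N, cancel g f}.
  move=> j jN; rewrite /f; case: pickP => [k /andP[kN /eqP E]|/(_ j)]; last first.
    by rewrite jN eqxx.
  exact: g_inj.
have sX0M : X0 \subset ground M by apply/subsetP=> _ /imsetP[j jN ->]; apply: gM.
have dX0C : [disjoint X0 & C].
  by apply/pred0P=> x /=; apply/andP=> -[/imsetP[j jN ->]]; apply/negP/gC.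
exists C, (ground M :\: (C :|: X0)); split=> //.
- exact: subsetDl.
- by apply/pred0P=> x /=; rewrite !inE; case: (x \in C) => //=; rewrite andbF.
have groundE : ground (delete (contract M C) (ground M :\: (C :|: X0))) = X0.
  apply/setP=> x; rewrite /= !inE; case xX: (x \in X0); rewrite ?orbT /=.
    by rewrite (subsetP sX0M) // (disjointFr dX0C xX).
  by rewrite orbF; case: (x \in C); case: (x \in ground M).
have fX0 : f @: X0 = ground N.
  rewrite /X0 -imset_comp -[RHS]imset_id; apply: eq_in_imset => j jN.
  exact: gK.
exists f; rewrite groundE; split=> //.
  by move=> _ _ /imsetP[j jN ->] /imsetP[k kN ->]; rewrite !gK // => ->.
move=> X sX; have sXM := subset_trans sX sX0M.
have XE : X = g @: (f @: X).
  rewrite -imset_comp -[LHS]imset_id.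
  apply: eq_in_imset => x /(subsetP sX)/imsetP[j jN ->] /=.
  by rewrite gK.
have sfX : f @: X \subset ground N by rewrite -fX0 imsetS.
have -> : indep (delete (contract M C) (ground M :\: (C :|: X0))) X =
          indep (contract M C) X.
  rewrite /= andb_idl // => _; apply/subsetP=> x xX.
  have xX0 := subsetP sX x xX.
  by move/setP: groundE => /(_ x); rewrite xX0 /= inE => /andP[].
have -> := contract_indepE Cp sXM (disjointWl sX dX0C).
rewrite indepN // {1}XE.
rewrite free_family_imset; last first.
  by move=> j k /(subsetP sfX) jN /(subsetP sfX); apply: g_inj.
apply/esym/free_family_sign=> j /(subsetP sfX)/gw; exact.
Qed.
End Minors.

(** * The minors M(K_4) and P_7 *)

Section K4P7.
Local Open Scope ring_scope.
Variables (T : finType) (M : matroid T) (m : nat).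
Notation V := 'cV['F_3]_m.
Variable v : T -> V.
Hypothesis indepE : forall X : {set T}, X \subset ground M ->
  indep M X = free_family v X.

Lemma points_sym p : symmetric_set (points M v p).
Proof.
have sub x : x \in points M v p -> - x \in points M v p.
  move=> /pointsP[x0 [y yM yx]]; apply/pointsP; rewrite oppr_eq0; split=> //.
  by exists y => //; case: yx => ->; rewrite ?opprK; [right|left].
by move=> x; apply/idP/idP=> [/sub|/sub//]; rewrite opprK.
Qed.

Lemma K4_minor C p : contraction M v C p -> K4_config (points M v p) -> has_minor M MK4.
Proof.
move=> Cp [a [b [c [/free3P fr [[aS bS cS] [abS acS bcS]]]]]].
have symS := points_sym p; set S := points M v p in aS bS cS abS acS bcS symS *.
pose u (i : 'I_4) := [:: 0; a; b; c]`_i.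
have uS i j : i != j -> u i - u j \in S.
  rewrite /u; case: i => [[|[|[|[|//]]]] ?]; case: j => [[|[|[|[|//]]]] ?] // _ /=;
    by rewrite ?sub0r ?subr0 // -symS ?opprK ?opprB.
have u_affine (al : 'I_4 -> 'F_3) : \sum_z al z = 0 ->
    \sum_z al z *: u z = 0 -> forall z, al z = 0.
  move=> s0; rewrite !big_ord_recl big_ord0 /u /= scaler0 add0r addr0 addrA => /fr[a1 a2 a3].
  move: s0; rewrite !big_ord_recl big_ord0 a1 a2 a3 !addr0 => a0.
  case=> [[|[|[|[|//]]]] lti];
    [rewrite -[RHS]a0 | rewrite -[RHS]a1 | rewrite -[RHS]a2 | rewrite -[RHS]a3];
    by congr al; apply: val_inj.
pose w (e : {set 'I_4}) :=
  if [pick xy : 'I_4 * 'I_4 | (xy.1 != xy.2) && (e == [set xy.1; xy.2])] is Some xy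
  then u xy.1 - u xy.2 else 0.
have wE e : e \in ground MK4 -> exists i j, [/\ i != j, e = [set i; j] & w e = u i - u j].
  rewrite inE => /cards2P[i [j [ij Ee]]]; rewrite /w.
  case: pickP => [[k l] /andP[kl /eqP->]|/(_ (i, j))]; first by exists k, l.
  by rewrite /= ij Ee eqxx.
have w_edge x y : x != y -> [set x; y] \in edges (complete_graph 'I_4) ->
    w [set x; y] = u x - u y \/ w [set x; y] = u y - u x.
  move=> xy eG; have [i [j [ij Ee ->]]] := wE _ eG.
  have : i \in [set x; y] by rewrite Ee set21.
  have : j \in [set x; y] by rewrite Ee set22.
  by case/set2P=> Ej /set2P[] Ei; move: ij; rewrite ?Ei ?Ej ?eqxx //; [right|left].
apply: (minor_of_points indepE Cp (w := w)).
- by apply/set0Pn; exists [set ord0; ord_max]; rewrite inE cards2.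
- by move=> Y sY; apply: (forest_free u_affine w_edge).
- by move=> e /wE[i [j [ij _ ->]]]; apply: uS.
move=> e f eG fG Ewf; have [i [j [ij Ee we]]] := wE e eG.
have [k [l [kl Ef wf]]] := wE f fG.
have [s Es] : exists s : 'F_3, w e = s *: w f.
  by case: Ewf => ->; [exists 1; rewrite scale1r | exists (-1); rewrite scaleN1r].
have sum1 r : \sum_z (z == r)%:R = 1 :> 'F_3.
  by rewrite (bigD1 r) //= eqxx big1 ?addr0 // => z /negPf->.
have sumu r : \sum_z (z == r)%:R *: u z = u r.
  by rewrite (bigD1 r) //= eqxx big1 ?addr0 ?scale1r // => z /negPf->; rewrite scale0r.
(* If two edges had proportional vectors, al would be an affine dependency; its
   vanishing at both ends of e puts them in f. *)
pose al z : 'F_3 := ((z == i)%:R - (z == j)%:R) - s * ((z == k)%:R - (z == l)%:R).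
have al0 : forall z, al z = 0.
  apply: u_affine; first by rewrite sumrB -mulr_sumr !sumrB !sum1 subrr mulr0 subr0.
  transitivity (w e - s *: w f); last by rewrite Es subrr.
  rewrite we wf -!sumu -!sumrB scaler_sumr -sumrB; apply: eq_bigr => z _.
  by rewrite /al !scalerBl -scalerA scalerBl.
have sub r : (r == i) != (r == j) -> r \in f.
  rewrite Ef !inE => rij; apply: contraTT (eqxx (al r)) => /norP[/negPf rk /negPf rl].
  rewrite {1}/al rk rl subrr mulr0 subr0 al0.
  by case: (r == i) rij; case: (r == j).
apply/eqP; rewrite eqEcard.
have -> : (#|e| = #|f|)%N by rewrite Ee Ef !cards2 ij kl.
rewrite leqnn andbT Ee; apply/subsetP=> r /set2P[] ->; apply: sub.
  by rewrite eqxx (negPf ij).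
by rewrite eqxx [j == i]eq_sym (negPf ij).
Qed.

Lemma P7_minor C p : contraction M v C p -> P7_config (points M v p) -> has_minor M P7.
Proof.
move=> Cp [a [b [c [/free3P fr [[aS bS cS] [abcS bcS acS abS]]]]]].
set S := points M v p in aS bS cS abcS bcS acS abS *.
pose B : 'M['F_3]_(m, 3) := \matrix_(r, i) [:: a; b; c]`_i r 0.
have BE (x : 'cV_3) : B *m x = x 0 0 *: a + x 1 0 *: b + x (inord 2) 0 *: c.
  apply/matrixP=> r s; rewrite !mxE !big_ord_recl big_ord0 !mxE /= addr0 addrA !(ord1 s).
  rewrite ![_ * x _ _]mulrC; congr (x _ _ * _ + x _ _ * _ + x _ _ * _);
    by apply: val_inj; rewrite /= ?inordK.
have B_inj : injective (mulmx B : 'cV_3 -> V).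
  move=> x y /eqP; rewrite -subr_eq0 -mulmxBr BE => /eqP/fr[x0 x1 x2].
  apply/matrixP=> i j; rewrite (ord1 j); apply/eqP; rewrite -subr_eq0; apply/eqP.
  have : (x - y) i 0 = 0.
    case: i => [[|[|[|//]]] lti]; [rewrite -[RHS]x0 | rewrite -[RHS]x1 | rewrite -[RHS]x2];
      by congr ((x - y) _ _); apply: val_inj; rewrite /= ?inordK.
  by rewrite !mxE.
pose w (j : 'I_7) := B *m col j P7mx.
apply: (minor_of_points indepE Cp (w := w)).
- by apply/set0Pn; exists ord0; rewrite inE.
- by move=> Y _; rewrite [RHS](free_family_linear (L := mulmx B)).
- have P7E j : w j = P7mx 0 j *: a + P7mx 1 j *: b + P7mx (inord 2) j *: c.
    by rewrite /w BE !mxE.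
  move=> j _; rewrite P7E !mxE inordK //.
  case: j => [[|[|[|[|[|[|[|//]]]]]]] ltj] /=;
    rewrite ?scale0r ?scale1r ?scaleN1r ?add0r ?addr0 //.
move=> j k _ _ wjk; have [s s0 Ejk] : exists2 s : 'F_3, s != 0 & w j = s *: w k.
  by case: wjk => ->; [exists 1; rewrite ?scale1r | exists (-1); rewrite ?scaleN1r].
have {Ejk}E i : P7mx i j = s * P7mx i k.
  have /matrixP/(_ i 0) : col j P7mx = s *: col k P7mx by apply: B_inj; rewrite -scalemxAr.
  by rewrite !mxE.
move: s0 (E 0) (E 1) (E (inord 2)); rewrite !mxE inordK //.
case: (F3P s) => -> // _; case: j {wjk E} => [[|[|[|[|[|[|[|//]]]]]]] ltj];
  case: k => [[|[|[|[|[|[|[|//]]]]]]] ltk];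
  by [ move=> *; apply: val_inj | move=> /eqP | move=> _ /eqP | move=> _ _ /eqP].
Qed.
End K4P7.

(** * Projections of a represented matroid *)

Section Closure.
Local Open Scope ring_scope.
Variables (T : finType) (M : matroid T) (m : nat).
Notation V := 'cV['F_3]_m.
Variable v : T -> V.
Implicit Types (C : {set T}) (p : 'End(V)) (e : V).

Definition project_from e : 'End(V) := (\1 - projv <[e]>)%VF.

Lemma project_fromP e (x : V) :
  reflect (exists t, x = t *: e) (project_from e x == 0).
Proof.
rewrite /project_from add_lfunE opp_lfunE id_lfunE subr_eq0.
apply: (iffP eqP) => [Ex|[t ->]].
  have : x \in <[e]>%VS by rewrite Ex memv_proj.
  by case/vlineP=> t; exists t.
by rewrite projv_id // memvZ // memv_line.
Qed.

Lemma contraction_step C p (x0 : T) :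
  contraction M v C p -> x0 \in ground M -> p (v x0) != 0 ->
  contraction M v (x0 |: C) (project_from (p (v x0)) \o p)%VF.
Proof.
case=> sCM fC kerp x0M px0.
have x0N : v x0 \notin <<[seq v x | x <- enum C]>>%VS by rewrite -kerp memv_ker.
have x0C : x0 \notin C.
  by apply: contraNN x0N => x0C; rewrite memv_span // map_f // mem_enum.
split; first by rewrite subUset sub1set x0M.
  by rewrite free_familyU1 // x0N.
rewrite (eq_span (perm_mem (perm_map v (perm_enum_setU1 x0C)))) /= span_cons -kerp.
apply/vspaceP=> z; rewrite memv_ker comp_lfunE.
apply/project_fromP/memv_addP=> [[t Et]|[_ /vlineP[t ->] [y yk ->]]].
  exists (t *: v x0); first by rewrite memvZ ?memv_line.
  exists (z - t *: v x0); last by rewrite addrC subrK.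
  by rewrite memv_ker linearB linearZ /= Et subrr.
by move: yk; rewrite memv_ker => /eqP yk; exists t; rewrite linearD linearZ /= yk addr0.
Qed.

Lemma points_step p e :
  points M v (project_from e \o p)%VF = projection (points M v p) (project_from e).
Proof.
apply/setP=> y; rewrite [RHS]inE in_set1; apply/pointsP/andP=> -[y0].
  case=> x xM yx; split=> //; apply/imsetP.
  have px0 : p (v x) != 0.
    by apply: contraNneq y0 => E; case: yx => ->; rewrite comp_lfunE /= E linear0 ?oppr0.
  exists (if y == project_from e (p (v x)) then p (v x) else - p (v x)).
    apply/pointsP; split; first by case: ifP; rewrite ?oppr_eq0.
    by exists x => //; case: ifP; [left|right].
  case: ifP => [/eqP//|]; rewrite linearN /=.
  by case: yx => ->; rewrite comp_lfunE /= // eqxx.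
case/imsetP=> z /pointsP[_ [x xM zx]] yz; split=> //; exists x => //.
by rewrite comp_lfunE yz /=; case: zx => ->; [left|right; rewrite linearN].
Qed.

Hypothesis indepE : forall X : {set T}, X \subset ground M ->
  indep M X = free_family v X.

(** The family to which pair_bound is applied consists of the projections of M along
    independent sets; it is closed under projection from a point by
    contraction_step and points_step. *)
Lemma long_pairs_lt : ground M != set0 -> (forall x, x \in ground M -> v x != 0) ->
  ~ has_minor M MK4 -> ~ has_minor M P7 ->
  (npairs (points M v \1) < 12 * #|points M v \1|)%N.
Proof.
move=> /set0Pn[x0 x0M] v0 noK4 noP7.
apply: (pair_bound (P := fun S => exists C p, contraction M v C p /\ S = points M v p)).
- move=> _ [C [p [Cp ->]]]; split.
  + exact: points_sym.
  + by apply/pointsP=> -[]; rewrite eqxx.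
  + by move=> K4; apply/noK4/(K4_minor indepE Cp).
  by move=> P; apply/noP7/(P7_minor indepE Cp).
- move=> _ e [C [p [Cp ->]]] /pointsP[e0 [x xM ex]].
  have px0 : p (v x) != 0 by case: ex e0 => ->; rewrite ?oppr_eq0.
  exists (project_from (p (v x))); split.
  + apply/eqP/project_fromP; case: ex => ->; first by exists 1; rewrite scale1r.
    by exists (-1); rewrite scaleN1r.
  + move=> y /eqP/project_fromP[t ->]; case: ex => ->; first by exists t.
    by exists (- t); rewrite scaleNr scalerN opprK.
  exists (x |: C), (project_from (p (v x)) \o p)%VF; split; last by rewrite points_step.
  exact: contraction_step.
- exists set0, \1%VF; split=> //; split; first exact: sub0set.
    exact: free_family0.
  by rewrite enum_set0 span_nil; apply/vspaceP=> z; rewrite memv_ker memv0 id_lfunE.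
apply/set0Pn; exists (v x0); apply/pointsP; split; first exact: v0.
by exists x0 => //; left; rewrite id_lfunE.
Qed.
End Closure.

(** * Triangles and the final count *)

Section Triangles.
Variables (T : finType) (M : matroid T).
Hypothesis M_simple : simple_matroid M.
Implicit Types (C X : {set T}) (a b c t x : T).

Lemma simple_indep X : X \subset ground M -> #|X| <= 2 -> indep M X.
Proof.
move=> sXM leX; apply/negPn/negP=> nX.
have [|C minC sCX] := @minset_exists _ (dependent M) X; first by rewrite /dependent sXM.
have [C1 C2] := M_simple minC.
have := leq_trans (subset_leq_card sCX) leX.
case E: #|C| C1 C2 => [|[|[|//]]] //.
move/eqP: E; rewrite cards_eq0 => /eqP E; case/minsetP: minC => /andP[_].
by rewrite E indep0.
Qed.

Lemma triangle_ground C : triangle M C -> C \subset ground M.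
Proof. by case/andP=> /minsetP[/andP[]]. Qed.

Lemma triangle_third C t a : triangle M C -> t \in C -> a \in C -> a != t ->
  exists b, [/\ C = [set t; a; b], b != t & b != a].
Proof.
case/andP=> _ /eqP C3 tC aC at_.
have : #|C :\ t :\ a| = 1.
  by move: C3; rewrite (cardsD1 t) tC (cardsD1 a (C :\ t)) !inE at_ aC => -[].
move/eqP/cards1P=> [b Eb]; have : b \in C :\ t :\ a by rewrite Eb set11.
rewrite !inE => /and3P[ba bt bC]; exists b; split=> //.
apply/setP=> x; move/setP: Eb => /(_ x); rewrite !inE.
have [->|] := eqVneq x t; first by rewrite tC.
by have [->|] := eqVneq x a; first by rewrite aC.
Qed.

(** The union of the triangles has rank two and four elements. *)
Lemma two_triangles_on_edge C C' t a : triangle M C -> triangle M C' -> C != C' ->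
  a != t -> t \in C -> a \in C -> t \in C' -> a \in C' -> has_submatroid M U24.
Proof.
move=> TC TC' CC' at_ tC aC tC' aC'.
have [b [EC bt ba]] := triangle_third TC tC aC at_.
have [c [EC' ct ca]] := triangle_third TC' tC' aC' at_.
have bc : b != c by apply: contraNneq CC' => E; rewrite EC EC' E.
have depC : ~~ indep M C by case/andP: TC => /minsetP[/andP[]].
have depC' : ~~ indep M C' by case/andP: TC' => /minsetP[/andP[]].
pose s := [:: t; a; b; c].
have us : uniq s.
  by rewrite /s /= !inE !negb_or [t == a]eq_sym [t == b]eq_sym [t == c]eq_sym
     [a == b]eq_sym [a == c]eq_sym at_ bt ct ba ca bc.
pose X := [set x in s].
have sXM : X \subset ground M.
  have H := subsetP (triangle_ground TC); have H' := subsetP (triangle_ground TC').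
  apply/subsetP=> x; rewrite !inE => /or4P[]/eqP->;
    by [apply: H | apply: H; rewrite EC !inE eqxx ?orbT
        | apply: H'; rewrite EC' !inE eqxx ?orbT].
exists X; split=> //.
have gX : ground (restrict M X) = X by apply/setIidPr.
pose f x : 'I_4 := inord (index x s).
have f_inj : {in X &, injective f}.
  have lt x : x \in s -> index x s < 4 by rewrite -index_mem.
  move=> x y; rewrite 2!in_set => xs ys /(congr1 (@nat_of_ord 4)).
  rewrite /f !inordK ?lt // => E.
  by rewrite -(nth_index t xs) E nth_index.
have cX : #|X| = 4 by rewrite cardsE (card_uniqP us).
exists f; rewrite gX; split=> //.
  by apply/eqP; rewrite eqEcard subsetT cardsT card_ord card_in_imset // cX.
move=> Y sYX; rewrite /= sYX /= card_in_imset; last first.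
  by move=> x y /(subsetP sYX) xX /(subsetP sYX); apply: f_inj.
apply/idP/idP=> [iY|]; last by apply: simple_indep; apply: subset_trans sXM.
rewrite leqNgt; apply/negP=> ltY.
have ita : indep M [set t; a].
  apply: simple_indep; last by rewrite cards2; case: (_ != _).
  by apply: subset_trans sXM; apply/subsetP=> x /set2P[]->; rewrite !inE eqxx ?orbT.
have [|x /setDP[xY]] := indep_aug ita iY.
  by rewrite cards2; case: (_ != _) => //; apply: ltnW.
rewrite !inE negb_or => /andP[xt xa]; have := subsetP sYX x xY.
rewrite !inE (negPf xt) (negPf xa) /= => /orP[]/eqP->; rewrite setUC => iC.
  by case/negP: depC; rewrite EC.
by case/negP: depC'; rewrite EC'.
Qed.

Definition triangle_nbrs t :=
  [set a | (a != t) && [exists C, [&& triangle M C, t \in C & a \in C]]].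

(** By two_triangles_on_edge, the triangles at t have only t in common. *)
Lemma card_triangle_nbrs t : ~ has_submatroid M U24 ->
  2 * #|[set C : {set T} | triangle M C && (t \in C)]| <= #|triangle_nbrs t|.
Proof.
move=> noU; set A := [set C | _ & _].
pose P := [set C :\ t | C in A].
have inj : {in A &, injective (fun C => C :\ t)}.
  move=> C C'; rewrite !inE => /andP[_ tC] /andP[_ tC'] E.
  by rewrite -(setD1K tC) E setD1K.
have trivP : trivIset P.
  apply/trivIsetP=> _ _ /imsetP[C CA ->] /imsetP[C' CA' ->] ne.
  move: CA CA'; rewrite !inE => /andP[TC tC] /andP[TC' tC'].
  apply/pred0P=> a /=; rewrite !inE; apply/negP=> /andP[/andP[at_ aC] /andP[_ aC']].
  apply: noU; apply: (two_triangles_on_edge TC TC' _ at_) => //.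
  by apply: contraNneq ne => ->.
have <- : cover P = triangle_nbrs t.
  apply/setP=> a; rewrite inE.
  apply/bigcupP/andP=> [[_ /imsetP[C + ->]]|[at_ /existsP[C /and3P[TC tC aC]]]].
    rewrite !inE => /andP[TC tC] /andP[at_ aC]; split=> //.
    by apply/existsP; exists C; rewrite TC tC.
  by exists (C :\ t); rewrite ?inE ?at_ //; apply/imsetP; exists C; rewrite // inE TC.
rewrite -(eqP trivP) big_imset //= mulnC -sum_nat_const; apply: leq_sum => C.
rewrite inE => /andP[/andP[_ /eqP C3] tC].
by move: C3; rewrite (cardsD1 t) tC add1n => -[->].
Qed.

Section Represented.
Local Open Scope ring_scope.
Variables (m : nat) (v : T -> 'cV['F_3]_m).
Hypothesis indepE : forall X, X \subset ground M -> indep M X = free_family v X.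

Lemma simple_nonparallel x y (s : 'F_3) :
  x \in ground M -> y \in ground M -> v x = s *: v y -> x = y.
Proof.
move=> xM yM E; apply/eqP/negPn/negP=> xy.
have : indep M [set x; y].
  apply: simple_indep; last by rewrite cards2; case: (_ != _).
  by apply/subsetP=> z /set2P[]->.
rewrite indepE; last by apply/subsetP=> z /set2P[]->.
move/free_familyP/(_ (fun z => if z == x then 1 else - s)).
rewrite big_setU1 ?inE //= big_set1 eqxx [y == x]eq_sym (negPf xy).
rewrite scale1r scaleNr E subrr => /(_ erefl x).
by rewrite set21 eqxx => /(_ isT)/eqP; rewrite oner_eq0.
Qed.

Lemma simple_nonzero x : x \in ground M -> v x != 0.
Proof.
move=> xM; apply/eqP=> vx.
have : indep M [set x] by apply: simple_indep; rewrite ?sub1set ?cards1.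
rewrite indepE ?sub1set // => /free_familyP/(_ (fun=> 1)).
rewrite big_set1 vx scaler0 => /(_ erefl x); rewrite set11 => /(_ isT)/eqP.
by rewrite oner_eq0.
Qed.

(** The third vector of the triangle is a combination of the two others, with both
    coefficients 1 or -1. *)
Lemma triangle_long_pair t a : t \in ground M -> a \in triangle_nbrs t ->
  long_pair (points M v \1) (v t) (v a).
Proof.
move=> tM; rewrite inE => /andP[at_ /existsP[C /and3P[TC tC aC]]].
have [b [EC bt ba]] := triangle_third TC tC aC at_.
have CM := subsetP (triangle_ground TC); have aM := CM a aC.
have bM : b \in ground M by apply: CM; rewrite EC !inE eqxx ?orbT.
have mem x : x \in ground M -> v x \in points M v \1.
  move=> xM; apply/pointsP; split; first exact: simple_nonzero.
  by exists x => //; left; rewrite id_lfunE.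
have ne x y (s : 'F_3) : x \in ground M -> y \in ground M -> y != x -> v y != s *: v x.
  by move=> xM yM; apply: contraNneq => /(simple_nonparallel yM xM)->.
have sta : [set t; a] \subset ground M by apply/subsetP=> x /set2P[]->.
have : ~~ indep M (b |: [set t; a]).
  by rewrite setUC -EC; case/andP: TC => /minsetP[/andP[]].
rewrite indepE; last by rewrite subUset sub1set bM.
rewrite free_familyU1; last by rewrite !inE negb_or bt ba.
have -> : free_family v [set t; a].
  by rewrite -indepE // simple_indep // cards2; case: (_ != _).
rewrite andbT negbK => /span_familyP[c].
rewrite big_setU1 ?inE 1?eq_sym //= big_set1 => Eb.
have ca : c a != 0.
  by apply/eqP=> c0; move: (ne t b (c t) tM bM bt); rewrite Eb c0 scale0r addr0 eqxx.
have ct : c t != 0.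
  by apply/eqP=> c0; move: (ne a b (c a) aM bM ba); rewrite Eb c0 scale0r add0r eqxx.
have symS := points_sym M v \1.
have n1 : v a != v t by rewrite -[v t]scale1r ne.
have n2 : v a != - v t by rewrite -scaleN1r ne.
rewrite /long_pair !mem // n1 n2 /=.
have := mem b bM; rewrite Eb.
move: ca ct; case: (F3P (c a)) => ->; case: (F3P (c t)) => -> //=;
  rewrite ?scale1r ?scaleN1r ?eqxx // => _ _ H; apply/orP.
- by left.
- by right; rewrite -symS opprB addrC.
- by right.
by left; rewrite -symS opprD.
Qed.

Lemma long_degree (x : 'cV['F_3]_m) : ~ has_submatroid M U24 ->
  (forall t, t \in ground M -> (3 <= #|[set C : {set T} | triangle M C && (t \in C)]|)%N) ->
  x \in points M v \1 -> (12 <= #|[set y | long_pair (points M v \1) x y]|)%N.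
Proof.
move=> noU tri; have symS := points_sym M v \1; set S := points M v \1 in symS *.
have lN y z : long_pair S (- y) z = long_pair S y z.
  by rewrite long_pairC // long_pairNr // long_pairC.
case/pointsP=> _ [t tM xt].
have -> : [set y | long_pair S x y] = [set y | long_pair S (v t) y].
  by apply/setP=> y; rewrite !inE; case: xt => ->; rewrite ?lN id_lfunE.
have NM a : a \in triangle_nbrs t -> a \in ground M.
  rewrite inE => /andP[_ /existsP[C /and3P[TC _ aC]]].
  exact: subsetP (triangle_ground TC) a aC.
have vinj : {in triangle_nbrs t &, injective v}.
  by move=> a b /NM aM /NM bM E; apply: (@simple_nonparallel _ _ 1); rewrite ?scale1r.
have Nvinj : {in triangle_nbrs t &, injective (fun a => - v a)}.
  by move=> a b aN bN /oppr_inj; apply: vinj.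
pose A := [set v a | a in triangle_nbrs t].
pose B := [set - v a | a in triangle_nbrs t].
have dAB : [disjoint A & B].
  apply/pred0P=> y /=; apply/negP=> /andP[/imsetP[a aN ->] /imsetP[b bN E]].
  have ab : a = b by apply: (@simple_nonparallel _ _ (-1)); rewrite ?NM ?scaleN1r.
  move: (simple_nonzero (NM a aN)); rewrite -eq_opp0 {1}E ab eqxx //.
have sAB : A :|: B \subset [set y | long_pair S (v t) y].
  apply/subsetP=> y /setUP[]/imsetP[a aN ->]; rewrite inE ?long_pairNr //;
  exact: triangle_long_pair.
apply: leq_trans (subset_leq_card sAB).
rewrite cardsU disjoint_setI0 // cards0 subn0 !card_in_imset //.
by have := card_triangle_nbrs t noU; have := tri t tM; lia.
Qed.
End Represented.
End Triangles.

Lemma npairs_sum m (S : {set 'cV['F_3]_m}) (n : nat) :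
  (forall x, x \in S -> (n <= #|[set y | long_pair S x y]|)%N) ->
  (n * #|S| <= npairs S)%N.
Proof.
move=> deg; rewrite mulnC -sum_nat_const.
apply: (@leq_trans (\sum_(x in S) #|[set y | long_pair S x y]|)%N); first exact: leq_sum.
rewrite /npairs -sum1_card (partition_big (fun xy => xy.1) (mem S)) /=; last first.
  by move=> xy; rewrite inE => /and5P[].
apply: leq_sum => x xS; rewrite sum1_card.
have inj : injective (fun y : 'cV['F_3]_m => (x, y)) by move=> y y' [].
rewrite -(card_imset _ inj); apply/subset_leq_card/subsetP=> _ /imsetP[y xy ->].
by rewrite unfold_in /= eqxx andbT inE; rewrite inE in xy.
Qed.

Theorem theorem2 (T : finType) (M : matroid T)
    (M_simple : simple_matroid M) (M_ternary : ternary M)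
    (M_nonempty : ground M != set0)
    (M_triangles : forall e : T, e \in ground M ->
       3 <= #|[set C : {set T} | triangle M C && (e \in C)]|) :
  has_minor M P7 \/ has_minor M MK4 \/ has_submatroid M U24.
Proof.
have [|noP7] := classic (has_minor M P7); first by left.
have [|noK4] := classic (has_minor M MK4); first by right; left.
have [|noU] := classic (has_submatroid M U24); first by right; right.
have [m [n [A [f [f_inj _ indepf]]]]] := M_ternary.
pose v := (fun j => col j A) \o f.
have indepE (X : {set T}) : X \subset ground M -> indep M X = free_family v X.
  move=> sXM; rewrite indepf //= free_family_imset //.
  by move=> x y /(subsetP sXM) xM /(subsetP sXM); apply: f_inj.
have := long_pairs_lt indepE M_nonempty (simple_nonzero M_simple indepE) noK4 noP7.
rewrite ltnNge npairs_sum // => x.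
exact: long_degree.
Qed.
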